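(* Let $\{\Gamma(l,n,m): l,n,m\in\mathbb{N}\}$ be a locally finite infinite family of pairwise disjoint segments in $[0,1)$. Set $\Gamma(l,n):=\bigcup_{m\in\mathbb{N}}\Gamma(l,n,m)$ for $l,n\in\mathbb{N}$. Let $\varepsilon>0$, $g\in H(\mathbb{D})$, and let $D$ be a closed disc centred at $0$ and contained in $\mathbb{D}$. There exist a family $\{r(l,n):l,n\in\mathbb{N}\}$ in $[0,1)$ and a function $f\in H(\mathbb{D})$ such that $\sup_D|f-g|<\varepsilon$ and such that for any $l,n\in\mathbb{N}$ and any $r\in\Gamma(l,n)\cap[r(l,n),1)$, $f\circ\phi_r\in V_n(l)$.
   Context: $\mathbb{N}=\{0,1,2,\dots\}$, $\mathbb{D}$ is the open unit disc of $\mathbb{C}$, $\mathbb{T}$ the unit circle, $H(\mathbb{D})$ the space of holomorphic functions on $\mathbb{D}$, $\mathcal{C}(K)$ the space of continuous complex functions on a compact set $K$ with the uniform norm. For $r\in[0,1)$, $\phi_r(z)=rz$; ''$f\circ\phi_r\in V$'' with $V\subset\mathcal{C}(K)$ means that the restriction of $f\circ\phi_r$ to $K$ belongs to $V$. $(K_l)_{l\in\mathbb{N}}$ is a fixed sequence of compact subsets of $\mathbb{T}$ with connected complement (so each is different from $\mathbb{T}$) such that every compact $K\subset\mathbb{T}$ with $K\neq\mathbb{T}$ is contained in some $K_l$. For each $l\in\mathbb{N}$, $(V_n(l))_{n\in\mathbb{N}}$ is a fixed sequence of non-empty open balls of $\mathcal{C}(K_l)$ forming a base of the topology of $\mathcal{C}(K_l)$.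 A segment is a compact interval (possibly reduced to a point). A countable family $\mathcal{F}$ of compact subsets of $[0,1)$ is locally finite if every compact set $K\subset[0,1)$ intersects at most finitely many sets of $\mathcal{F}$. *)

(* Defs.v *)
From HB Require Import structures.
From mathcomp Require Import all_boot all_order all_algebra.
From mathcomp Require Import all_classical all_reals topology ereal normedtype derive.
From mathcomp Require Import complex.

Set Implicit Arguments.
Unset Strict Implicit.
Unset Printing Implicit Defensive.

Import Order.TTheory GRing.Theory Num.Theory.
Import numFieldNormedType.Exports.

Local Open Scope classical_set_scope.
Local Open Scope ring_scope.
Local Open Scope complex_scope.

(* R[i] receives the topology and the normed-module structure of R[i]^o, i.e.
   those given by the modulus; they are not inferred on R[i] otherwise. *)
HB.instance Definition _ (R : realType) := GRing.ComAlgebra.copy R[i] R[i]^o.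
HB.instance Definition _ (R : realType) := Vector.copy R[i] R[i]^o.
HB.instance Definition _ (R : realType) := NormedModule.copy R[i] R[i]^o.

(* The modulus with values in R; `|z| is this real number seen in R[i]. *)
Definition cmod (R : realType) (z : R[i]) : R := complex.Re `|z|.

Definition unit_disc (R : realType) : set R[i] := [set z | cmod z < 1].

Definition unit_circle (R : realType) : set R[i] := [set z | cmod z = 1].

Arguments unit_disc : clear implicits.
Arguments unit_circle : clear implicits.

Definition closed_disc (R : realType) (rho : R) : set R[i] :=
  [set z | cmod z <= rho].

(* Derivability along 1 over the field R[i] is complex differentiability. *)
Definition holomorphic_on (R : realType) (U : set R[i]) (f : R[i] -> R[i]) :=
  forall z, U z -> derivable f z 1.

Definition dilation (R : realType) (r : R) (z : R[i]) : R[i] := r%:C * z.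

(* The supremum of |f| over D, in the extended reals. *)
Definition sup_on (R : realType) (D : set R[i]) (f : R[i] -> R[i]) : \bar R :=
  ereal_sup [set (cmod (f z))%:E | z in D].

Definition segment (R : realType) (A : set R) :=
  exists a b : R, a <= b /\ A = `[a, b]%classic.

Definition locally_finite (R : realType) (I : Type) (F : I -> set R) :=
  forall K : set R, compact K -> K `<=` `[0, 1[%classic ->
    finite_set [set i | K `&` F i !=set0].

Section modulus.
Variable R : realType.
Implicit Types z w : R[i].

Lemma cmodE z : `|z| = (cmod z)%:C.
Proof. by rewrite /cmod normc_def. Qed.

Lemma cmod_ge0 z : 0 <= cmod z.
Proof. by rewrite /cmod normc_def sqrtr_ge0. Qed.

Lemma cmod0 : cmod (0 : R[i]) = 0.
Proof. by rewrite /cmod normr0. Qed.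

Lemma cmod_eq0 z : cmod z = 0 -> z = 0.
Proof. by move=> z0; apply/normr0_eq0; rewrite cmodE z0. Qed.

Lemma ler_cmodD z w : cmod (z + w) <= cmod z + cmod w.
Proof. by have := ler_normD z w; rewrite !cmodE -rmorphD lecR. Qed.

Lemma cmodM z w : cmod (z * w) = cmod z * cmod w.
Proof. by apply: complexI; rewrite rmorphM -!cmodE normrM. Qed.

Lemma cmodBC z w : cmod (z - w) = cmod (w - z).
Proof. by rewrite /cmod distrC. Qed.

Lemma cmod_continuous : continuous (@cmod R).
Proof.
move=> z; apply/(@cvgrPdist_le _ _ _ _ (nbhs_filter z)) => e e0.
have e0' : 0 < e%:C by rewrite ltcR.
have := (@cvgr_dist_le _ _ _ _ (nbhs_filter z) id z cvg_id _ e0').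
apply: (@filterS _ _ (nbhs_filter z)) => w.
rewrite cmodE lecR; apply: le_trans; rewrite ler_norml; apply/andP; split.
  by rewrite lerBrDl lerBlDr cmodBC addrC (le_trans _ (ler_cmodD _ _))// subrK.
by rewrite lerBlDr (le_trans _ (ler_cmodD _ _))// subrK.
Qed.

End modulus.

Section pointwise.
Variables (R : realType) (X : topologicalType).
Implicit Types f g : X -> R[i].

Lemma ctsN f : continuous f -> continuous (fun x => - f x).
Proof. by move=> cf x; apply: cvgN; exact: cf. Qed.

Lemma ctsD f g :
  continuous f -> continuous g -> continuous (fun x => f x + g x).
Proof. by move=> cf cg x; apply: cvgD; [exact: cf|exact: cg]. Qed.

Lemma ctsZ (c : R[i]) f : continuous f -> continuous (fun x => c * f x).
Proof. by move=> cf x; apply: cvgM; [exact: cvg_cst|exact: cf]. Qed.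

Lemma cts_cmod f : continuous f -> continuous (fun x => cmod (f x)).
Proof.
by move=> cf x; apply: continuous_comp; [exact: cf|exact: cmod_continuous].
Qed.

End pointwise.

Section continuous_functions.
Variables (R : realType) (K : set R[i]).

Lemma compact_set_type : compact K -> compact [set: set_type K].
Proof.
move=> cK F PF _.
have PG : ProperFilter ((set_val : K -> R[i]) @ F) by exact: fmap_proper_filter.
have GK : ((set_val : K -> R[i]) @ F) K.
  by apply: (@filterS _ F _ setT) => [[x xK] _|]; [exact: set_mem xK|exact: filterT].
have [p [Kp clp]] := cK _ PG GK.
exists (exist _ p (mem_set Kp)); split => // A B FA [_ [[W oW <-] /= Wp] WB].
have GA : ((set_val : K -> R[i]) @ F) (set_val @` A).
  by apply: (@filterS _ F _ A) => // x Ax; exists x.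
have [_ [[a Aa <-] Wa]] := clp _ _ GA (open_nbhs_nbhs (conj oW Wp)).
by exists a; split => //; exact: WB.
Qed.

(* The space of continuous functions on the compact set K, where K carries the
   topology induced by R[i]. The compactness proof is a parameter because it is
   what makes the supremum norm below finite. *)
Definition continuous_on_compact (cK : compact K) :=
  continuousType (set_type K) R[i].

Variable cK : compact K.
Local Notation CK := (continuous_on_compact cK).
Implicit Types f g h : CK.

HB.instance Definition _ := Choice.on CK.

Lemma cts_eqP f g : f =1 g -> f = g.
Proof. by move=> fg; apply/continuousEP. Qed.

Let zero : CK := mkcts (@cst_continuous K R[i] 0).

Let opp f : CK := mkcts (ctsN (@cts_fun _ _ f)).
Let add f g : CK := mkcts (ctsD (@cts_fun _ _ f) (@cts_fun _ _ g)).
Let scale (c : R[i]) f : CK := mkcts (ctsZ (c := c) (@cts_fun _ _ f)).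

Let addA : associative add.
Proof. by move=> f g h; apply: cts_eqP => x /=; rewrite /mkcts addrA. Qed.
Let addC : commutative add.
Proof. by move=> f g; apply: cts_eqP => x /=; rewrite /mkcts addrC. Qed.
Let add0 : left_id zero add.
Proof. by move=> f; apply: cts_eqP => x /=; rewrite /mkcts add0r. Qed.
Let addN : left_inverse zero opp add.
Proof. by move=> f; apply: cts_eqP => x /=; rewrite /mkcts addNr. Qed.

HB.instance Definition _ := GRing.isZmodule.Build CK addA addC add0 addN.

Let scaleA (a b : R[i]) f : scale a (scale b f) = scale (a * b) f.
Proof. by apply: cts_eqP => x /=; rewrite /mkcts mulrA. Qed.
Let scale1 : left_id 1 scale.
Proof. by move=> f; apply: cts_eqP => x /=; rewrite /mkcts mul1r. Qed.
Let scaleDr : right_distributive scale +%R.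
Proof. by move=> a f g; apply: cts_eqP => x /=; rewrite /mkcts mulrDr. Qed.
Let scaleDl f : {morph scale^~ f : a b / a + b}.
Proof. by move=> a b; apply: cts_eqP => x /=; rewrite /mkcts mulrDl. Qed.

HB.instance Definition _ :=
  GRing.Zmodule_isLmodule.Build R[i] CK scaleA scale1 scaleDr scaleDl.

(* For K empty, the supremum of the empty set is 0 in R, as it should. *)
Definition sup_cmod f : R := sup (range (fun x : K => cmod (f x))).

Lemma cmod_has_ubound f : has_ubound (range (fun x : K => cmod (f x))).
Proof.
have cf := cts_cmod (@cts_fun _ _ f).
have : compact (range (fun x : K => cmod (f x))).
  apply: continuous_compact; last exact: compact_set_type.
  exact: continuous_subspaceT.
move=> /(@compact_bounded R R^o)[M [_ bM]].
exists (M + 1) => y /(bM (M + 1) (ltr_pwDr ltr01 (lexx M))) /=.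
by apply: le_trans; exact: ler_norm.
Qed.

Lemma le_sup_cmod f (x : K) : cmod (f x) <= sup_cmod f.
Proof. by apply: ub_le_sup; [exact: cmod_has_ubound|exists x]. Qed.

Lemma sup_cmod_le f (M : R) :
  0 <= M -> (forall x : K, cmod (f x) <= M) -> sup_cmod f <= M.
Proof.
move=> M0 fM; rewrite /sup_cmod.
have [->|/set0P ne] := eqVneq (range (fun x : K => cmod (f x))) set0.
  by rewrite sup0.
by apply: ge_sup => // _ [x _ <-].
Qed.

Lemma sup_cmod_ge0 f : 0 <= sup_cmod f.
Proof.
rewrite /sup_cmod.
have [->|/set0P[_ [x _ _]]] := eqVneq (range (fun x : K => cmod (f x))) set0.
  by rewrite sup0.
exact: le_trans (cmod_ge0 _) (le_sup_cmod f x).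
Qed.

Let norm f : R[i] := (sup_cmod f)%:C.

Let ler_normD f g : norm (f + g) <= norm f + norm g.
Proof.
rewrite -rmorphD lecR sup_cmod_le ?addr_ge0 ?sup_cmod_ge0// => x.
by rewrite (le_trans (ler_cmodD _ _))// lerD// le_sup_cmod.
Qed.

Let normrZ (c : R[i]) f : norm (c *: f) = `|c| * norm f.
Proof.
rewrite cmodE -rmorphM; congr _%:C.
have leZ (d : R[i]) g : sup_cmod (d *: g) <= cmod d * sup_cmod g.
  apply: sup_cmod_le => [|x]; first by rewrite mulr_ge0 ?cmod_ge0 ?sup_cmod_ge0.
  by rewrite cmodM ler_wpM2l ?cmod_ge0 ?le_sup_cmod.
have [->|c0] := eqVneq c 0.
  apply/eqP; rewrite cmod0 mul0r eq_le sup_cmod_ge0 andbT.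
  by apply: sup_cmod_le => // x; rewrite /= /mkcts mul0r cmod0.
apply/eqP; rewrite eq_le leZ /=.
have := leZ c^-1 (c *: f); rewrite scalerA mulVf// scale1r.
have cM : cmod c * cmod c^-1 = 1.
  by rewrite -cmodM divff// /cmod normr1.
move=> /(ler_wpM2l (cmod_ge0 c)) /le_trans; apply.
by rewrite mulrA cM mul1r.
Qed.

Let normr0_eq0 f : norm f = 0 -> f = 0.
Proof.
move=> /complexI f0; apply: cts_eqP => x; apply: cmod_eq0.
by apply/eqP; rewrite eq_le cmod_ge0 andbT -f0 le_sup_cmod.
Qed.

HB.instance Definition _ :=
  Lmodule_isNormed.Build R[i] CK ler_normD normrZ normr0_eq0.

Lemma cts_normE f : `|f| = (sup_cmod f)%:C.
Proof. by []. Qed.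

End continuous_functions.

Definition open_ball (R : realType) (K : set R[i]) (cK : compact K)
    (A : set (continuous_on_compact cK)) :=
  exists (h : continuous_on_compact cK) (e : R), 0 < e /\ A = ball h e%:C.

Definition restriction_in (R : realType) (K : set R[i]) (cK : compact K)
    (u : R[i] -> R[i]) (A : set (continuous_on_compact cK)) :=
  exists2 h, A h & (h : set_type K -> R[i]) = sigL K u.

(* Main.v *)
Require Import Defs.
From mathcomp Require Import all_boot all_order all_algebra.
From mathcomp Require Import all_classical all_reals topology ereal normedtype derive.
From mathcomp Require Import complex.
From mathcomp Require Import realfun.
From mathcomp Require Import cyclic separable cyclotomic.
From mathcomp Require Import ring lra.

(** The function sought has the form [f = g * A + B], where [A] and [B] are
    locally uniform limits of polynomials on the unit disc. The segments are
    treated one after the other, in the order of their left endpoints. Suppose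
    that the current function is [u = g * A + B] and that the next segment is
    [t = [a, b]], with target compact set [K] and target polynomial [P] (a
    polynomial close on [K] to the centre of the prescribed ball). Choose [c]
    smaller than [a] but larger than the right endpoints of all previous
    segments, and a polynomial [chi] close to 0 on the disc of radius [c] and
    close to 1 on the sector of all [r * z] with [r] in [t] and [z] in [K].
    Replace [u] by [u * (1 - chi) + P * chi], that is, [A] by [A * (1 - chi)]
    and [B] by [B * (1 - chi) + P * chi] ([correction_step]). This changes
    little on the disc of radius [c], and the new function is close to [P] on
    the sector. As [c] tends to 1, the polynomials [A] and [B] converge locally
    uniformly, so their limits are holomorphic ([poly_limit], which rests on
    the Cauchy estimates for polynomials); [prescribed_on_segments] collects
    what is obtained. The limit is only close to [P (r * z)], whereas the value
    wanted is near [P z]; since [P] is Lipschitz on the disc, the two are close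
    once [r] is close to 1, and this, together with the fact that the first few
    errors are not small, is why [r (l, n)] is needed.

    Two approximation results are used. The first is the existence of [chi]
    ([separating_poly]). For large [N] the rational function
    [z ^+ N / (z ^+ N - rho ^+ N)] with [c < rho < a] does what is wanted of
    [chi], and its poles can be moved, along a connected set that stays away
    from the disc and the sector, to infinity: first along the circle of radius
    [rho], then along a ray through a point of the unit circle outside [K]
    ([approx_pole_connected]). The second is that every continuous function on
    a proper compact subset [K] of the circle is a uniform limit of polynomials
    ([approx_continuous]). Again by moving a pole, [1 / z] is such a limit on
    [K]; hence so are the weights [(1 - |z - k| ^+ 2 / 4) ^+ n], which
    concentrate at [k] as [n] grows, and a continuous function is approached by
    its averages with respect to these weights, [k] ranging over a fine net. *)

Import Order.TTheory GRing.Theory Num.Theory.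
Import numFieldNormedType.Exports.

Local Open Scope classical_set_scope.
Local Open Scope ring_scope.
Local Open Scope complex_scope.

Set Implicit Arguments.
Unset Strict Implicit.

(** * The modulus *)

Section Modulus.
Variable R : realType.
Implicit Types z w : R[i].

Lemma cmod1 : cmod (1 : R[i]) = 1.
Proof. by rewrite /cmod normr1. Qed.

Lemma cmodN z : cmod (- z) = cmod z.
Proof. by rewrite /cmod normrN. Qed.

Lemma cmodX z n : cmod (z ^+ n) = cmod z ^+ n.
Proof. by elim: n => [|n IH]; rewrite ?expr0 ?cmod1// !exprS cmodM IH. Qed.

Lemma cmodV z : cmod z^-1 = (cmod z)^-1.
Proof. by apply: complexI; rewrite -cmodE normfV cmodE fmorphV. Qed.

Lemma cmod_real (x : R) : cmod x%:C = `|x|.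
Proof. by apply: complexI; rewrite -cmodE normc_def /= expr0n addr0 sqrtr_sqr. Qed.

Lemma cmodB_le z w : cmod (z - w) <= cmod z + cmod w.
Proof. by rewrite (le_trans (ler_cmodD _ _))// cmodN. Qed.

Lemma cmod_dist_le z w v : cmod (z - w) <= cmod (z - v) + cmod (v - w).
Proof. by rewrite -[z - w](subrKA v) ler_cmodD. Qed.

Lemma lerB_cmod z w : cmod z - cmod w <= cmod (z - w).
Proof. by rewrite lerBlDr (le_trans _ (ler_cmodD _ _))// subrK. Qed.

Lemma cmod_gt0 z : (0 < cmod z) = (z != 0).
Proof.
rewrite lt_def cmod_ge0 andbT; congr (~~ _).
by apply/eqP/eqP => [/cmod_eq0//|->]; rewrite cmod0.
Qed.

Lemma cmod_sum (I : Type) (r : seq I) (F : I -> R[i]) :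
  cmod (\sum_(i <- r) F i) <= \sum_(i <- r) cmod (F i).
Proof.
elim: r => [|i r IH]; rewrite ?big_nil ?cmod0// !big_cons.
by rewrite (le_trans (ler_cmodD _ _))// lerD2l.
Qed.

Lemma cmod_Re z : `|complex.Re z| <= cmod z.
Proof.
case: z => x y; rewrite /cmod normc_def /= -{1}sqrtr_sqr.
by rewrite ler_wsqrtr// lerDl sqr_ge0.
Qed.

Lemma cmod_Im z : `|complex.Im z| <= cmod z.
Proof.
case: z => x y; rewrite /cmod normc_def /= -{1}sqrtr_sqr.
by rewrite ler_wsqrtr// lerDr sqr_ge0.
Qed.

Lemma cmod_ReIm z : cmod z <= `|complex.Re z| + `|complex.Im z|.
Proof.
rewrite {1}[z]complexE (le_trans (ler_cmodD _ _))// cmodM !cmod_real.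
by rewrite /cmod normc_def /= expr0n add0r expr1n sqrtr1 mul1r.
Qed.

(** Neighbourhoods in terms of the real-valued modulus, so that no complex-valued
    radius appears below. *)
Lemma nbhs_cmodP z (A : set R[i]) :
  nbhs z A <-> exists2 d : R, 0 < d & forall w, cmod (w - z) < d -> A w.
Proof.
split=> [/nbhs_ballP[e /= e0 eA]|[d d0 dA]].
  exists (complex.Re e); first by move: e0; rewrite ltcE => /andP[].
  move=> w zw; apply: eA; rewrite -ball_normE /= distrC cmodE.
  move: e0; rewrite !ltcE /= => /andP[/eqP ie _].
  by rewrite ie eqxx.
apply/nbhs_ballP; exists d%:C; first by rewrite /= ltcR.
by move=> w; rewrite -ball_normE /= distrC cmodE ltcR => /dA.
Qed.

End Modulus.

(** * Cauchy estimates for polynomials *)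

Section CauchyEstimate.
Variable R : realType.
Implicit Types q : {poly R[i]}.

Lemma prim_root_exists n : (0 < n)%N -> exists w : R[i], n.-primitive_root w.
Proof.
move=> n0; pose p : {poly R[i]} := 'X^n - 1.
have [r Dp] := closed_field_poly_normal p.
move: Dp; rewrite (monicP _) ?monicXnsubC // scale1r => Dp.
have rn : all n.-unity_root r by apply/allP=> z; rewrite -root_prod_XsubC -Dp.
have sz_r : (n < (size r).+1)%N.
  by rewrite -(size_prod_XsubC r id) -Dp size_XnsubC.
have Ur : uniq r.
  rewrite -separable_prod_XsubC -Dp separable_Xn_sub_1 //.
  by rewrite pnatr_eq0 -lt0n.
have /hasP[z _ zn] := has_prim_root n0 rn Ur sz_r.
by exists z.
Qed.

Lemma prim_root_cmod n (w : R[i]) : n.-primitive_root w -> cmod w = 1.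
Proof.
move=> pw; have n0 := prim_order_gt0 pw.
have := congr1 (@cmod R) (prim_expr_order pw); rewrite cmodX cmod1 => /eqP.
by rewrite pexpr_eq1 ?cmod_ge0// => /eqP.
Qed.

(** The coefficient [q`_j] is recovered by averaging [q] over [n]-th roots of
    unity, [n] being larger than the degree. *)
Lemma cauchy_estimate q (s M : R) (j : nat) : 0 <= s ->
  (forall z, cmod z <= s -> cmod q.[z] <= M) -> cmod q`_j * s ^+ j <= M.
Proof.
move=> s0 qM; have M0 : 0 <= M.
  by apply: le_trans (cmod_ge0 _) (qM 0 _); rewrite cmod0.
have [jq|jq] := leqP (size q) j; first by rewrite nth_default// cmod0 mul0r.
have n0 : (0 < size q)%N by exact: leq_ltn_trans jq.
have [w pw] := prim_root_exists n0; set n := size q in n0 pw jq.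
have w1 := prim_root_cmod pw.
have wn := prim_expr_order pw.
have w0 : w != 0 by rewrite -cmod_gt0 w1.
(* Fourier inversion: summing over [m] kills all coefficients but [q`_j] *)
have E : \sum_(m < n) q.[s%:C * w ^+ m] * w ^- (j * m) =
    n%:R * (q`_j * s%:C ^+ j).
  transitivity (\sum_(i < n) q`_i * s%:C ^+ i *
      \sum_(m < n) (w ^+ i / w ^+ j) ^+ m).
    under eq_bigr do rewrite horner_coef mulr_suml.
    rewrite exchange_big; apply: eq_bigr => i _ /=; rewrite mulr_sumr.
    apply: eq_bigr => m _.
    rewrite exprMn -!exprM exprMn exprVn -!exprM [(m * i)%N]mulnC.
    by rewrite !mulrA.
  rewrite (bigD1 (Ordinal jq))//= divff ?expf_neq0//.
  rewrite [X in _ + X]big1 ?addr0.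
    under eq_bigr do rewrite expr1n.
    by rewrite sumr_const card_ord mulrC.
  move=> i ij; set x := _ / _.
  have xn : x ^+ n = 1.
    by rewrite exprMn exprVn -!exprM ![(_ * n)%N]mulnC !exprM wn !expr1n divr1.
  have x1 : x - 1 != 0.
    rewrite subr_eq0; apply: contra ij => /eqP xE.
    have : w ^+ i = w ^+ j by rewrite -[LHS](divfK (expf_neq0 j w0)) -/x xE mul1r.
    move/eqP; rewrite (eq_prim_root_expr pw) !modn_small//.
  have := subrX1 x n; rewrite xn subrr => /esym/eqP.
  by rewrite mulf_eq0 (negPf x1) /= => /eqP ->; rewrite mulr0.
have : cmod (n%:R * (q`_j * s%:C ^+ j)) <= n%:R * M.
  rewrite -E (le_trans (cmod_sum _ _))//.
  have -> : n%:R * M = \sum_(m < n) M by rewrite sumr_const card_ord mulr_natl.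
  apply: ler_sum => m _.
  rewrite cmodM cmodV cmodX w1 expr1n invr1 mulr1 qM//.
  by rewrite cmodM cmodX w1 expr1n mulr1 cmod_real ger0_norm.
have nR : n%:R = n%:R%:C :> R[i] by rewrite rmorph_nat.
rewrite !cmodM cmodX cmod_real ger0_norm// nR cmod_real ger0_norm//.
by rewrite ler_pM2l// ltr0n.
Qed.

(** The derivative of [q] at [z0], defined as the coefficient of degree 1 of the
    Taylor expansion at [z0], to which the Cauchy estimates apply directly. *)
Definition taylor1 q (z0 : R[i]) : R[i] := (q \Po ('X + z0%:P))`_1.

Lemma taylor1B p q z0 : taylor1 (p - q) z0 = taylor1 p z0 - taylor1 q z0.
Proof. by rewrite /taylor1 comp_polyB coefB. Qed.

Lemma taylor1_le q z0 (s M : R) : 0 < s ->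
  (forall z, cmod (z - z0) <= s -> cmod q.[z] <= M) ->
  cmod (taylor1 q z0) <= M / s.
Proof.
move=> s0 qM; rewrite ler_pdivlMr// -[X in _ * X]expr1.
apply: cauchy_estimate; first exact: ltW.
move=> z zs; rewrite horner_comp !hornerE; apply: qM.
by rewrite addrK.
Qed.

(** The remainder at order 2 is controlled by the supremum of [q] alone, with no
    dependence on the degree. *)
Lemma taylor1_remainder q z0 (s M : R) h : 0 < s ->
  (forall z, cmod (z - z0) <= s -> cmod q.[z] <= M) -> cmod h <= s / 2 ->
  cmod (q.[z0 + h] - q.[z0] - taylor1 q z0 * h) <= 2 * M / s ^+ 2 * cmod h ^+ 2.
Proof.
move=> s0 qM hs; rewrite /taylor1; set p := q \Po _.
have pM z : cmod z <= s -> cmod p.[z] <= M.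
  by move=> zs; rewrite horner_comp !hornerE; apply: qM; rewrite addrK.
have M0 : 0 <= M.
  by apply: le_trans (cmod_ge0 _) (pM 0 _); rewrite cmod0 ltW.
have coefM j : cmod p`_j <= M / s ^+ j.
  by rewrite ler_pdivlMr ?exprn_gt0//; apply: cauchy_estimate (ltW s0) pM.
have -> : q.[z0 + h] = p.[h] by rewrite horner_comp !hornerE addrC.
have -> : q.[z0] = p`_0 by rewrite -horner_coef0 horner_comp !hornerE.
have ph : p.[h] = \sum_(i < (size p).+2) p`_i * h ^+ i.
  by rewrite (@horner_coef_wide _ (size p).+2)// leqW.
rewrite ph 2!big_ord_recl /= expr0 mulr1 expr1 /bump /=; set S := bigop _ _ _.
rewrite [X in cmod X](_ : _ = S); last by ring.
rewrite {}/S (le_trans (cmod_sum _ _))//.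
pose x := cmod h / s.
have x0 : 0 <= x by rewrite divr_ge0 ?cmod_ge0// ltW.
have x2 : x <= 2^-1 by rewrite ler_pdivrMr// mulrC.
apply: (@le_trans _ _ (\sum_(i < size p) M * x ^+ 2 * 2^-1 ^+ i)).
  apply: ler_sum => i _; rewrite cmodM cmodX.
  have -> : (1 + (1 + i) = i.+2)%N by [].
  apply: (@le_trans _ _ (M * x ^+ i.+2)).
    have -> : M * x ^+ i.+2 = M / s ^+ i.+2 * cmod h ^+ i.+2.
      by rewrite /x exprMn exprVn; ring.
    by apply: ler_wpM2r; [rewrite exprn_ge0 ?cmod_ge0|exact: coefM].
  have -> : M * x ^+ i.+2 = M * x ^+ 2 * x ^+ i by rewrite -addn2 exprD; ring.
  apply: ler_wpM2l; first by rewrite mulr_ge0 ?exprn_ge0.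
  by apply: lerXn2r; rewrite // nnegrE invr_ge0.
rewrite -mulr_sumr.
have -> : 2 * M / s ^+ 2 * cmod h ^+ 2 = M * x ^+ 2 * 2.
  by rewrite /x exprMn exprVn; ring.
apply: ler_wpM2l; first exact: mulr_ge0 M0 (exprn_ge0 2 x0).
have E n : \sum_(i < n) 2^-1 ^+ i = 2 - 2 * 2^-1 ^+ n :> R.
  elim: n => [|n IH]; first by rewrite big_ord0 expr0 mulr1 subrr.
  by rewrite big_ord_recr /= IH exprS; field.
by rewrite E lerBlDr lerDl mulr_ge0// exprn_ge0// invr_ge0.
Qed.

End CauchyEstimate.

(** * Holomorphic limits of polynomials *)

Section Limits.
Variable R : realType.
Implicit Types (u : nat -> R[i]) (x e : nat -> R).

Lemma geometric_small (C e : R) : 0 < e ->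
  exists k0, forall k, (k0 <= k)%N -> C / 2 ^+ k <= e.
Proof.
move=> e0; exists (Num.bound (`|C| / e)) => k kb.
rewrite ler_pdivrMr ?exprn_gt0// mulrC -ler_pdivrMr//.
apply: (@le_trans _ _ (`|C| / e)).
  by rewrite ler_wpM2r ?ler_norm// invr_ge0 ltW.
apply: le_trans (ltW (archi_boundP _)) _; first by rewrite divr_ge0// ltW.
by rewrite -natrX ler_nat (leq_trans kb)// ltnW// ltn_expl.
Qed.

Lemma geometric_telescope u (C : R) k0 : 0 <= C ->
  (forall k, (k0 <= k)%N -> cmod (u k.+1 - u k) <= C / 2 ^+ k) ->
  forall j k, (k0 <= j)%N -> (j <= k)%N -> cmod (u k - u j) <= 2 * C / 2 ^+ j.
Proof.
move=> C0 uC j k k0j jk.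
suff : cmod (u k - u j) <= 2 * C / 2 ^+ j - 2 * C / 2 ^+ k.
  move=> /le_trans; apply.
  by rewrite lerBlDr lerDl divr_ge0 ?exprn_ge0 ?mulr_ge0.
elim: k jk => [|k IH]; first by rewrite leqn0 => /eqP ->; rewrite !subrr cmod0.
rewrite leq_eqVlt => /orP[/eqP <-|]; first by rewrite !subrr cmod0.
rewrite ltnS => jk; apply: le_trans (cmod_dist_le _ _ (u k)) _.
apply: le_trans (lerD (uC k (leq_trans k0j jk)) (IH jk)) _.
rewrite le_eqVlt; apply/orP; left; apply/eqP.
by rewrite [in RHS]exprS; field; rewrite !expf_neq0// pnatr_eq0.
Qed.

(** Completeness of the reals: the limit is the supremum of the lower bounds
    [x k - e k]. *)
Lemma nested_limit x e k0 :
  (forall j k, (k0 <= j)%N -> (j <= k)%N -> `|x k - x j| <= e j) ->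
  exists l, forall j, (k0 <= j)%N -> `|l - x j| <= e j.
Proof.
move=> xe; pose S := [set x k - e k | k in [set k | (k0 <= k)%N]].
have e_ge0 j : (k0 <= j)%N -> 0 <= e j by move=> ?; apply: le_trans (xe j j _ _).
have Sub j : (k0 <= j)%N -> ubound S (x j + e j).
  move=> k0j _ [k /= k0k <-]; have [jk|/ltnW kj] := leqP j k.
    have := xe j k k0j jk; rewrite ler_norml => /andP[_].
    by have := e_ge0 _ k0k; have := e_ge0 _ k0j; lra.
  have := xe k j k0k kj; rewrite ler_norml => /andP[+ _].
  by have := e_ge0 _ k0k; have := e_ge0 _ k0j; lra.
have S0 : S !=set0 by exists (x k0 - e k0); exists k0 => /=.
exists (sup S) => j k0j; rewrite ler_norml; apply/andP; split.
  rewrite lerBrDr addrC; apply: ub_le_sup; last by exists j.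
  by exists (x k0 + e k0); exact: Sub.
by rewrite lerBlDr addrC; apply: ge_sup => //; exact: Sub.
Qed.

Lemma geometric_cauchy u (C : R) k0 : 0 <= C ->
  (forall k, (k0 <= k)%N -> cmod (u k.+1 - u k) <= C / 2 ^+ k) ->
  exists l, forall k, (k0 <= k)%N -> cmod (l - u k) <= 4 * C / 2 ^+ k.
Proof.
move=> C0 uC; have T := geometric_telescope C0 uC.
have [a ua] : exists a : R, forall j, (k0 <= j)%N ->
    `|a - complex.Re (u j)| <= 2 * C / 2 ^+ j.
  apply: nested_limit => j k k0j jk; rewrite -raddfB.
  exact: le_trans (cmod_Re _) (T j k k0j jk).
have [b ub] : exists b : R, forall j, (k0 <= j)%N ->
    `|b - complex.Im (u j)| <= 2 * C / 2 ^+ j.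
  apply: nested_limit => j k k0j jk; rewrite -raddfB.
  exact: le_trans (cmod_Im _) (T j k k0j jk).
exists (a +i* b) => k k0k; rewrite (le_trans (cmod_ReIm _))// !raddfB /=.
rewrite (le_trans (lerD (ua k k0k) (ub k k0k)))// le_eqVlt.
by apply/orP; left; apply/eqP; field; rewrite expf_neq0// pnatr_eq0.
Qed.

Lemma horner_bounded (q : {poly R[i]}) (M : R) : 0 <= M ->
  exists2 B : R, 0 <= B & forall z, cmod z <= M -> cmod q.[z] <= B.
Proof.
move=> M0; exists (\sum_(i < size q) cmod q`_i * M ^+ i).
  by apply: sumr_ge0 => i _; rewrite mulr_ge0 ?cmod_ge0 ?exprn_ge0.
move=> z zM; rewrite horner_coef (le_trans (cmod_sum _ _))//.
apply: ler_sum => i _; rewrite cmodM cmodX ler_wpM2l ?cmod_ge0//.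
by apply: lerXn2r; rewrite // nnegrE cmod_ge0.
Qed.

Lemma horner_lipschitz (q : {poly R[i]}) :
  exists2 C : R, 0 <= C & forall z w, cmod z <= 1 -> cmod w <= 1 ->
    cmod (q.[z] - q.[w]) <= C * cmod (z - w).
Proof.
elim/poly_ind: q => [|q c [C C0 IH]].
  by exists 0 => // z w _ _; rewrite !horner0 subrr cmod0 mul0r.
have [B B0 qB] := horner_bounded q ler01.
exists (C + B); first exact: addr_ge0.
move=> z w z1 w1; rewrite !hornerE.
have -> : q.[z] * z + c - (q.[w] * w + c) =
    (q.[z] - q.[w]) * z + q.[w] * (z - w) by ring.
rewrite (le_trans (ler_cmodD _ _))// [leRHS]mulrDl !cmodM lerD//.
  by rewrite -[leRHS]mulr1; apply: ler_pM; rewrite ?cmod_ge0 ?IH.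
by rewrite ler_wpM2r ?cmod_ge0 ?qB.
Qed.

(** A first order expansion with a quadratic remainder gives complex
    differentiability. *)
Lemma derivable_quadratic (f : R[i] -> R[i]) z L (C s : R) : 0 < s -> 0 <= C ->
  (forall h, cmod h <= s -> cmod (f (z + h) - f z - L * h) <= C * cmod h ^+ 2) ->
  derivable f z 1.
Proof.
move=> s0 C0 fC; apply: (cvgP L); apply/cvgrPdist_le => e e0.
move: (e0); rewrite ltcE /= => /andP[/eqP ie re].
apply/nbhs_cmodP; exists (Num.min s (complex.Re e / (C + 1))).
  by rewrite lt_min s0 divr_gt0// ltr_wpDl.
move=> h; rewrite subr0 lt_min => /andP[hs he] h0.
rewrite cmodE.
suff : cmod (L - h^-1 *: ((f \o shift z) (h *: 1) - f z)) <= complex.Re e.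
  by rewrite lecE /= -ie eqxx.
have -> : L - h^-1 *: ((f \o shift z) (h *: 1) - f z) =
          - (h^-1 * (f (z + h) - f z - L * h)).
  rewrite /= /shift /= [h *: 1]mulr1 [h + z]addrC.
  rewrite /GRing.scale /= [in RHS]mulrBr [L * h]mulrC mulKf//.
  by rewrite opprB.
have ch : 0 < cmod h by rewrite cmod_gt0.
rewrite cmodN cmodM cmodV mulrC ler_pdivrMr//.
apply: le_trans (fC h (ltW hs)) _; rewrite expr2 mulrA ler_wpM2r ?cmod_ge0//.
move: he; rewrite ltr_pdivlMr ?ltr_wpDl// => he; move: (ltW ch) (ltW he).
by rewrite mulrDr mulr1 mulrC; lra.
Qed.

(** A locally uniform limit of polynomials on the disc is holomorphic. The
    Cauchy estimates make the first two Taylor coefficients converge and bound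
    the Taylor remainders by a common multiple of [|h| ^+ 2]. *)
Lemma poly_limit (A : nat -> {poly R[i]}) (C : R) : 0 <= C ->
  (forall x : R, x < 1 -> exists k0, forall k, (k0 <= k)%N -> forall z, cmod z <= x ->
     cmod ((A k.+1).[z] - (A k).[z]) <= C / 2 ^+ k) ->
  exists2 F : R[i] -> R[i], holomorphic_on (unit_disc R) F &
    forall z, unit_disc R z -> forall e : R, 0 < e ->
      exists k0, forall k, (k0 <= k)%N -> cmod (F z - (A k).[z]) <= e.
Proof.
move=> C0 AC.
have /choice[F FP] (z : R[i]) : exists l, unit_disc R z -> forall e : R, 0 < e ->
      exists k0, forall k, (k0 <= k)%N -> cmod (l - (A k).[z]) <= e.
  have [z1|z1] := ltP (cmod z) 1; last first.
    by exists 0; rewrite /unit_disc/= ltNge z1.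
  have [k0 kP] := AC _ z1.
  have [l lP] := geometric_cauchy C0 (fun k k0k => kP k k0k z (lexx _)).
  exists l => _ e e0; have [k1 k1P] := geometric_small (4 * C) e0.
  exists (maxn k0 k1) => k; rewrite geq_max => /andP[h0 h1].
  exact: le_trans (lP k h0) (k1P k h1).
exists F => // z z1.
pose s : R := (1 - cmod z) / 2.
have s0 : 0 < s by rewrite divr_gt0// subr_gt0.
have xlt1 : cmod z + s < 1 by move: z1; rewrite /unit_disc /s /=; lra.
have in_x w : cmod (w - z) <= s -> cmod w <= cmod z + s.
  by move=> ws; have := lerB_cmod w z; lra.
have [k0 kP] := AC _ xlt1.
have [|M0 _ M0P] := @horner_bounded (A k0) (cmod z + s).
  by rewrite addr_ge0 ?cmod_ge0 ?ltW.
have AM k : (k0 <= k)%N -> forall w, cmod (w - z) <= s ->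
    cmod (A k).[w] <= M0 + 2 * C / 2 ^+ k0.
  move=> k0k w /in_x wx.
  have := geometric_telescope C0 (fun k k0k => kP k k0k w wx) (leqnn _) k0k.
  by have := lerB_cmod (A k).[w] (A k0).[w]; have := M0P w wx; lra.
set M := M0 + _ in AM.
have M_ge0 : 0 <= M.
  by apply: le_trans (cmod_ge0 _) (AM k0 (leqnn _) z _); rewrite subrr cmod0 ltW.
have [L LP] : exists l, forall k, (k0 <= k)%N ->
    cmod (l - taylor1 (A k) z) <= 4 * (C / s) / 2 ^+ k.
  apply: geometric_cauchy; first by rewrite divr_ge0// ltW.
  move=> k k0k; rewrite -taylor1B mulrAC; apply: taylor1_le => // w /in_x wx.
  by rewrite hornerD hornerN; exact: kP.
apply: (@derivable_quadratic F z L (2 * M / s ^+ 2) (s / 2)).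
- by rewrite divr_gt0.
- by rewrite divr_ge0 ?sqr_ge0 ?mulr_ge0.
move=> h hs; apply/ler_addgt0Pr => e e0.
have zh1 : unit_disc R (z + h).
  apply: le_lt_trans xlt1; rewrite (le_trans (ler_cmodD _ _))// lerD2l.
  by rewrite (le_trans hs)// ler_pdivrMr// ler_peMr ?ltW// ltr1n.
have e3 : 0 < e / 3 by rewrite divr_gt0.
have [k1 k1P] := FP _ zh1 _ e3.
have [k2 k2P] := FP _ z1 _ e3.
have [k3 k3P] := geometric_small (4 * (C / s) * cmod h) e3.
pose k := (k0 + k1 + k2 + k3)%N.
have k0k : (k0 <= k)%N by rewrite /k -!addnA leq_addr.
have k1k : (k1 <= k)%N by rewrite /k -!addnA addnCA leq_addr.
have k2k : (k2 <= k)%N by rewrite /k -addnA addnCA leq_addr.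
have k3k : (k3 <= k)%N by rewrite /k leq_addl.
have := taylor1_remainder s0 (AM k k0k) hs.
set B := _ * cmod h ^+ 2.
set t := _ - _ - _ * h => tB.
have -> : F (z + h) - F z - L * h = t + ((F (z + h) - (A k).[z + h]) -
   (F z - (A k).[z])) - (L - taylor1 (A k) z) * h.
  by rewrite /t; ring.
have h3 : cmod ((L - taylor1 (A k) z) * h) <= e / 3.
  rewrite cmodM; apply: le_trans (k3P k k3k).
  by rewrite [leRHS]mulrAC ler_wpM2r ?cmod_ge0//; exact: LP.
have := k1P k k1k; have := k2P k k2k; move: h3 tB.
set a := _ * h; set b := F z - _; set c := F (z + h) - _.
have := cmodB_le (t + (c - b)) a; have := ler_cmodD t (c - b).
by have := cmodB_le c b; lra.
Qed.

End Limits.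

(** * Uniform approximation by polynomials and displacement of poles *)

Section PolyApprox.
Variable R : realType.
Implicit Types (E C : set R[i]) (u v : R[i] -> R[i]) (z w : R[i]).

Lemma expr_small (q e : R) : 0 <= q -> q < 1 -> 0 < e ->
  exists n, q ^+ n <= e.
Proof.
move=> q0 q1 e0; have d0 : 0 < 1 - q by rewrite subr_gt0.
have B n : n%:R * (1 - q) * q ^+ n <= 1.
  suff : n%:R * (1 - q) * q ^+ n <= 1 - q ^+ n.
    by move=> /le_trans; apply; rewrite lerBlDr lerDl exprn_ge0.
  elim: n => [|n IH]; first by rewrite mul0r expr0 subrr mul0r.
  have -> : n.+1%:R * (1 - q) * q ^+ n.+1 =
      (n%:R * (1 - q) * q ^+ n) * q + (1 - q) * q ^+ n.+1.
    by rewrite exprS -natr1; ring.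
  apply: (le_trans (lerD (ler_wpM2r q0 IH) (lexx _))).
  have : 0 <= (1 - q) * (1 - q ^+ n.+1).
    by rewrite mulr_ge0 ?(ltW d0)// subr_ge0 exprn_ile1// ltW.
  move=> h; rewrite -subr_ge0; apply: (le_trans h); rewrite le_eqVlt.
  by apply/orP; left; apply/eqP; rewrite !exprS; ring.
exists (Num.bound ((1 - q) * e)^-1); set n := Num.bound _.
have : ((1 - q) * e)^-1 < n%:R.
  by apply: archi_boundP; rewrite invr_ge0 mulr_ge0 ?ltW.
rewrite -(@ltr_pM2r _ ((1 - q) * e)) ?mulr_gt0// mulVf; last first.
  by rewrite gt_eqF ?mulr_gt0.
rewrite mulrA => h; have n0 : 0 < n%:R * (1 - q).
  by rewrite -(pmulr_lgt0 _ e0) (lt_trans _ h).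
by rewrite -(ler_pM2l n0) (le_trans (B n))// ltW.
Qed.

(** Uniform approximability on [E] by polynomials. *)
Definition poly_approx E u := forall e : R, 0 < e ->
  exists q : {poly R[i]}, forall z, E z -> cmod (u z - q.[z]) <= e.

Lemma approx_cst E c : poly_approx E (fun=> c).
Proof. by move=> e e0; exists c%:P => z _; rewrite hornerC subrr cmod0 ltW. Qed.

Lemma approx_id E : poly_approx E id.
Proof. by move=> e e0; exists 'X => z _; rewrite hornerX subrr cmod0 ltW. Qed.

Lemma approx_lim E u :
  (forall e : R, 0 < e -> exists2 v, poly_approx E v &
     forall z, E z -> cmod (u z - v z) <= e) -> poly_approx E u.
Proof.
move=> uv e e0; have e2 : 0 < e / 2 by rewrite divr_gt0.
have [v /(_ _ e2)[q qP] vP] := uv _ e2; exists q => z Ez.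
by have := cmod_dist_le (u z) q.[z] (v z); have := vP _ Ez; have := qP _ Ez; lra.
Qed.

Lemma approx_ext E u v : (forall z, E z -> u z = v z) ->
  poly_approx E u -> poly_approx E v.
Proof. by move=> uv ua e /ua[q qP]; exists q => z Ez; rewrite -uv ?qP. Qed.

Lemma approx_add E u v : poly_approx E u -> poly_approx E v ->
  poly_approx E (fun z => u z + v z).
Proof.
move=> ua va e e0; have e2 : 0 < e / 2 by rewrite divr_gt0.
have [p pP] := ua _ e2; have [q qP] := va _ e2; exists (p + q) => z Ez.
rewrite hornerD opprD addrACA (le_trans (ler_cmodD _ _))//.
by have := pP _ Ez; have := qP _ Ez; lra.
Qed.

Section Bounded.
Variables (E : set R[i]) (M : R).
Hypotheses (M_ge0 : 0 <= M) (E_le : forall z, E z -> cmod z <= M).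

Lemma approx_bounded u : poly_approx E u ->
  exists2 B : R, 0 <= B & forall z, E z -> cmod (u z) <= B.
Proof.
move=> /(_ _ ltr01)[q qP]; have [B B0 BP] := horner_bounded q M_ge0.
exists (B + 1); first by rewrite addr_ge0.
move=> z Ez; have := BP _ (E_le Ez); have := qP _ Ez.
by have := lerB_cmod (u z) q.[z]; lra.
Qed.

Lemma approx_mul u v : poly_approx E u -> poly_approx E v ->
  poly_approx E (fun z => u z * v z).
Proof.
move=> ua va e e0; have [B B0 BP] := approx_bounded ua.
have e1 : 0 < e / 2 / (B + 1) by rewrite !divr_gt0// ltr_wpDl.
have [q qP] := va _ e1; have [D D0 DP] := horner_bounded q M_ge0.
have e2 : 0 < e / 2 / (D + 1) by rewrite !divr_gt0// ltr_wpDl.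
have [p pP] := ua _ e2; exists (p * q) => z Ez; rewrite hornerM.
have -> : u z * v z - p.[z] * q.[z] =
  u z * (v z - q.[z]) + (u z - p.[z]) * q.[z] by ring.
rewrite (le_trans (ler_cmodD _ _))// !cmodM [e]splitr lerD//.
  rewrite -[leRHS](mulfVK (_ : B + 1 != 0)) ?gt_eqF ?ltr_wpDl// mulrC.
  apply: ler_pM; rewrite ?cmod_ge0 ?qP// (le_trans (BP _ Ez))//.
  by rewrite lerDl.
rewrite -[leRHS](mulfVK (_ : D + 1 != 0)) ?gt_eqF ?ltr_wpDl//.
apply: ler_pM; rewrite ?cmod_ge0 ?pP// (le_trans (DP _ (E_le Ez)))//.
by rewrite lerDl.
Qed.

Lemma approx_exp u n : poly_approx E u -> poly_approx E (fun z => u z ^+ n).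
Proof.
move=> ua; elim: n => [|n IH]; first exact: approx_cst.
by apply: approx_ext (approx_mul ua IH) => z _; rewrite exprS.
Qed.

Lemma approx_sum (I : Type) (r : seq I) (F : I -> R[i] -> R[i]) :
  (forall i, poly_approx E (F i)) -> poly_approx E (fun z => \sum_(i <- r) F i z).
Proof.
move=> FE; elim: r => [|i r IH].
  by apply: approx_ext (approx_cst E 0) => z _; rewrite big_nil.
by apply: approx_ext (approx_add (FE i) IH) => z _; rewrite big_cons.
Qed.

Lemma approx_prod (I : eqType) (r : seq I) (F : I -> R[i] -> R[i]) :
  (forall i, i \in r -> poly_approx E (F i)) ->
  poly_approx E (fun z => \prod_(i <- r) F i z).
Proof.
elim: r => [|i r IH] FE.
  by apply: approx_ext (approx_cst E 1) => z _; rewrite big_nil.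
have FiE := FE i (mem_head _ _).
have FrE : poly_approx E (fun z => \prod_(j <- r) F j z).
  by apply: IH => j jr; apply: FE; rewrite in_cons jr orbT.
by apply: approx_ext (approx_mul FiE FrE) => z _; rewrite big_cons.
Qed.

(** The partial sums of the geometric series of ratio [u] converge uniformly. *)
Lemma approx_geometric u (q : R) : q < 1 -> (forall z, E z -> cmod (u z) <= q) ->
  poly_approx E u -> poly_approx E (fun z => (1 - u z)^-1).
Proof.
move=> q1 uq ua; have [/eqP E0|/set0P[z0 Ez0]] := boolP (E == set0).
  by move=> e e0; exists 0 => z; rewrite E0.
have q0 : 0 <= q := le_trans (cmod_ge0 _) (uq _ Ez0).
have d0 : 0 < 1 - q by rewrite subr_gt0.
apply: approx_lim => e e0.
have [n nP] := expr_small q0 q1 (mulr_gt0 e0 d0).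
exists (fun z => \sum_(i < n) u z ^+ i).
  by apply: approx_sum => i; exact: approx_exp.
move=> z Ez; have uz : 1 - q <= cmod (1 - u z).
  by have := lerB_cmod 1 (u z); rewrite cmod1; have := uq _ Ez; lra.
have uz0 : 1 - u z != 0 by rewrite -cmod_gt0 (lt_le_trans d0).
have -> : (1 - u z)^-1 - \sum_(i < n) u z ^+ i = u z ^+ n / (1 - u z).
  have -> : \sum_(i < n) u z ^+ i = (1 - u z ^+ n) / (1 - u z).
    apply: (mulIf uz0); rewrite divfK//.
    by have := subrX1 (u z) n; set S := bigop _ _ _ => h; rewrite -[RHS]opprB h; ring.
  by field.
rewrite cmodM cmodX cmodV ler_pdivrMr ?(lt_le_trans d0)//.
apply: (@le_trans _ _ (q ^+ n)).
  by apply: lerXn2r; rewrite ?nnegrE ?cmod_ge0 ?uq.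
by rewrite (le_trans nP)// ler_wpM2l// ltW.
Qed.

Lemma approx_pole_far w : M < cmod w -> poly_approx E (fun z => (z - w)^-1).
Proof.
move=> Mw; have w0 : 0 < cmod w := le_lt_trans M_ge0 Mw.
have wn0 : w != 0 by rewrite -cmod_gt0.
have h1 : poly_approx E (fun z => w^-1 * z).
  by apply: approx_mul; [exact: approx_cst|exact: approx_id].
have h2 : forall z, E z -> cmod (w^-1 * z) <= M / cmod w.
  by move=> z Ez; rewrite cmodM cmodV mulrC ler_wpM2r ?invr_ge0 ?cmod_ge0 ?E_le.
have h3 : M / cmod w < 1 by rewrite ltr_pdivrMr// mul1r.
apply: approx_ext (approx_mul (approx_cst E (- w^-1)) (approx_geometric h3 h2 h1)).
move=> z Ez /=; have zw : z - w != 0.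
  by rewrite subr_eq0; apply: contraTneq Mw => <-; rewrite -leNgt E_le.
have : 1 - w^-1 * z != 0.
  have -> : 1 - w^-1 * z = - (z - w) / w by field.
  by rewrite mulf_neq0 ?invr_eq0 ?oppr_eq0.
by move=> ?; field; rewrite wn0 zw /= -oppr_eq0 opprB zw.
Qed.

(** Expanding [1 / (z - w')] in powers of [(w' - w) / (z - w)] moves a pole by
    half its distance to [E]. *)
Lemma approx_pole_near w w' (d : R) : 0 < d ->
  (forall z, E z -> d <= cmod (z - w)) -> cmod (w' - w) <= d / 2 ->
  poly_approx E (fun z => (z - w)^-1) -> poly_approx E (fun z => (z - w')^-1).
Proof.
move=> d0 dE ww' wa.
have h1 := approx_mul (approx_cst E (w' - w)) wa.
have h2 z : E z -> cmod ((w' - w) * (z - w)^-1) <= 2^-1.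
  move=> Ez; rewrite cmodM cmodV ler_pdivrMr; last exact: lt_le_trans (dE _ Ez).
  rewrite (le_trans ww')// mulrC ler_wpM2l ?invr_ge0 ?dE//.
have h3 : 2^-1 < 1 :> R by rewrite invf_lt1// ltr1n.
apply: approx_ext (approx_mul wa (approx_geometric h3 h2 h1)) => z Ez.
have zw : z - w != 0 by rewrite -cmod_gt0 (lt_le_trans d0)// dE.
have zw' : z - w' != 0.
  rewrite -cmod_gt0; have := dE _ Ez; have := cmod_dist_le z w w'; lra.
rewrite -invfM; congr (_^-1); by field.
Qed.

(** A pole can be moved anywhere inside a connected set [C] at positive distance
    from [E]: the poles of [C] that are approximable form a relatively open and
    closed subset. *)
Lemma approx_pole_connected C w0 w (d : R) : connected C -> 0 < d ->
  (forall w z, C w -> E z -> d <= cmod (z - w)) -> C w0 -> C w ->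
  poly_approx E (fun z => (z - w0)^-1) -> poly_approx E (fun z => (z - w)^-1).
Proof.
move=> Cc d0 dCE Cw0 Cw w0a.
pose P := [set w | poly_approx E (fun z => (z - w)^-1)].
have d2 : 0 < d / 2 by rewrite divr_gt0.
have step a b : C a -> P a -> cmod (b - a) < d / 2 -> P b.
  move=> Ca Pa ab; apply: (@approx_pole_near a b d) Pa => //; last exact: ltW.
  by move=> z Ez; apply: dCE.
suff CP : C `&` P = C by move: Cw; rewrite -CP => -[].
apply: Cc; first by exists w0.
- exists [set b | exists2 a, (C `&` P) a & cmod (b - a) < d / 2].
    rewrite openE => b [a aP ab]; apply/nbhs_cmodP.
    exists (d / 2 - cmod (b - a)); first by rewrite subr_gt0.
    move=> b' b'b; exists a => //; have := cmod_dist_le b' a b; lra.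
  apply/seteqP; split => b [Cb].
    by move=> Pb; split => //; exists b => //; rewrite subrr cmod0.
  by move=> [a [Ca Pa] ab]; split => //; apply: step ab.
- exists (~` [set b | exists2 a, (C `&` ~` P) a & cmod (b - a) < d / 2]).
    rewrite closedC openE => b [a aP ab]; apply/nbhs_cmodP.
    exists (d / 2 - cmod (b - a)); first by rewrite subr_gt0.
    move=> b' b'b; exists a => //; have := cmod_dist_le b' a b; lra.
  apply/seteqP; split => b [Cb].
    move=> Pb; split => // -[a [Ca nPa]] ab; apply: nPa.
    by apply: (step b); rewrite // cmodBC.
  move=> nPb; split => //; apply: contrapT => nPb'; apply: nPb; exists b => //.
  by rewrite subrr cmod0.
Qed.

End Bounded.
End PolyApprox.

(** * Separation of a disc from a sector *)

Section Separation.
Variable R : realType.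
Implicit Types (E K : set R[i]) (z w zeta : R[i]).

Lemma continuous_RtoC : continuous (fun x : R => x%:C : R[i]).
Proof.
move=> x A /nbhs_cmodP[d d0 dA]; apply/nbhs_ballP; exists d => // y.
by rewrite -ball_normE /= distrC => xy; apply: dA; rewrite -rmorphB cmod_real.
Qed.

(** The pole comes from infinity along the ray through [zeta], which avoids [E]
    beyond [t0]. *)
Lemma approx_pole_ray E (M : R) zeta (t0 d : R) : 0 <= M ->
  (forall z, E z -> cmod z <= M) -> cmod zeta = 1 -> 0 < d -> 0 <= t0 ->
  (forall t z, t0 <= t -> E z -> d <= cmod (z - t%:C * zeta)) ->
  poly_approx E (fun z => (z - t0%:C * zeta)^-1).
Proof.
move=> M0 EM z1 d0 t00 dE; set T := t0 + M + 1.
have tT : t0 <= T by rewrite /T; lra.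
pose C := [set zeta * t%:C | t in [set t | t0 <= t]].
have Cc : connected C.
  apply: connected_continuous_connected.
    by apply/connected_intervalP => x y /= tx ty z /andP[xz zy]; exact: le_trans xz.
  by apply: continuous_subspaceT; apply: ctsZ; exact: continuous_RtoC.
have far : poly_approx E (fun z => (z - T%:C * zeta)^-1).
  apply: (approx_pole_far M0 EM); rewrite cmodM z1 mulr1 cmod_real ger0_norm /T; lra.
apply: (approx_pole_connected M0 EM Cc d0) far.
- by move=> w z [t /= t0t <-] Ez; rewrite mulrC; exact: dE.
- by exists T; rewrite //= mulrC.
- by exists t0; rewrite //= mulrC.
Qed.

(** From the point of argument [zeta], a pole reaches the whole circle: each half
    of the circle is the continuous image of [-1, 1] under the graph of a square
    root. *)
Lemma approx_pole_circle E (M : R) zeta (rho d : R) : 0 <= M ->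
  (forall z, E z -> cmod z <= M) -> cmod zeta = 1 -> 0 < d -> 0 < rho ->
  (forall w z, cmod w = rho -> E z -> d <= cmod (z - w)) ->
  poly_approx E (fun z => (z - rho%:C * zeta)^-1) ->
  forall w, cmod w = rho -> poly_approx E (fun z => (z - w)^-1).
Proof.
move=> M0 EM z1 d0 rho0 dE base w wrho.
have zn0 : zeta != 0 by rewrite -cmod_gt0 z1.
have rn0 : rho%:C != 0 :> R[i] by rewrite -cmod_gt0 cmod_real gtr0_norm.
have abs1 (x y : R) : x ^+ 2 + y ^+ 2 = 1 -> cmod (x%:C + 'i * y%:C) = 1.
  move=> xy; have -> : x%:C + 'i * y%:C = x +i* y by rewrite [RHS]complexE.
  by rewrite /cmod normc_def /= xy sqrtr1.
pose v := w / (rho%:C * zeta).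
have v1 : cmod v = 1.
  rewrite /v cmodM cmodV cmodM z1 mulr1 cmod_real gtr0_norm// wrho divff//.
  by rewrite gt_eqF.
have wE : w = rho%:C * zeta * v by rewrite /v; field; rewrite rn0 zn0.
have v2 : complex.Re v ^+ 2 + complex.Im v ^+ 2 = 1.
  have := congr1 (fun t => t ^+ 2) v1.
  by rewrite /cmod normc_def /= sqr_sqrtr ?addr_ge0 ?sqr_ge0// expr1n.
pose s : R := if 0 <= complex.Im v then 1 else - 1.
have s2 : s ^+ 2 = 1 by rewrite /s; case: ifP; rewrite ?sqrrN expr1n.
have sIm : s * `|complex.Im v| = complex.Im v.
  rewrite /s; case: ifPn => [/ger0_norm ->|]; first by rewrite mul1r.
  by rewrite -ltNge => /ltr0_norm ->; rewrite mulN1r opprK.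
pose f (x : R) := rho%:C * zeta * (x%:C + 'i * (s * Num.sqrt (1 - x ^+ 2))%:C).
have fc : continuous f.
  apply: ctsZ; apply: ctsD; first exact: continuous_RtoC.
  apply: ctsZ => x; apply: continuous_comp; last exact: continuous_RtoC.
  apply: cvgM; first exact: cvg_cst.
  apply: continuous_comp; last exact: sqrt_continuous.
  by apply: cvgB; [exact: cvg_cst|exact: exprn_continuous].
have Cc : connected (f @` `[-1, 1]).
  apply: connected_continuous_connected; first exact: segment_connected.
  exact: continuous_subspaceT.
apply: (approx_pole_connected M0 EM Cc d0) base.
- move=> w' z [x /=]; rewrite in_itv /= => /andP[x1 x1'] <-; apply: dE.
  rewrite /f !cmodM z1 mulr1 cmod_real gtr0_norm// abs1 ?mulr1//.
  rewrite exprMn s2 mul1r sqr_sqrtr ?subrKC// subr_ge0.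
  by rewrite -real_normK ?num_real// exprn_ile1// ler_norml x1.
- exists 1; first by rewrite /= in_itv /= lexx andbT; lra.
  by rewrite /f expr1n subrr sqrtr0 mulr0 rmorph0 mulr0 addr0 rmorph1 mulr1.
- exists (complex.Re v).
    by have := cmod_Re v; rewrite v1 ler_norml /= in_itv.
  rewrite /f -v2 addrAC subrr add0r sqrtr_sqr sIm -complexE.
  by rewrite -wE.
Qed.

(** A positive angle separates the rays through [zeta] and [zeta0]. *)
Lemma dist_ray_ge zeta zeta0 (r t delta : R) : cmod zeta = 1 -> cmod zeta0 = 1 ->
  0 <= r -> 0 <= t -> delta <= cmod (zeta - zeta0) ->
  r * delta / 2 <= cmod (r%:C * zeta - t%:C * zeta0).
Proof.
move=> z1 z01 r0 t0 dz.
have h1 : r * cmod (zeta - zeta0) - `|r - t| <= cmod (r%:C * zeta - t%:C * zeta0).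
  have := cmodB_le (r%:C * zeta - t%:C * zeta0) ((r - t)%:C * zeta0).
  have -> : r%:C * zeta - t%:C * zeta0 - (r - t)%:C * zeta0 = r%:C * (zeta - zeta0).
    by rewrite rmorphB /=; ring.
  by rewrite !cmodM !cmod_real z01 (ger0_norm r0); lra.
have h2 : `|r - t| <= cmod (r%:C * zeta - t%:C * zeta0).
  have := lerB_cmod (r%:C * zeta) (t%:C * zeta0).
  have := lerB_cmod (t%:C * zeta0) (r%:C * zeta).
  rewrite [cmod (t%:C * _ - _)]cmodBC !cmodM !cmod_real z1 z01.
  rewrite (ger0_norm r0) (ger0_norm t0) !mulr1.
  by move=> ? ?; rewrite ler_norml; lra.
by have := ler_wpM2l r0 dz; lra.
Qed.

(** Both closeness estimates for [z ^+ N / (z ^+ N - rho ^+ N)], near 0 and near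
    1, have this form. *)
Lemma cmod_quotient (p q : R[i]) (y : R) : q != 0 -> y <= 2^-1 ->
  cmod p <= y * cmod q -> cmod (p / (q - p)) <= 2 * y.
Proof.
move=> q0 y2 pq; have cq : 0 < cmod q by rewrite cmod_gt0.
have h := lerB_cmod q p.
have h3 : y * cmod q <= 2^-1 * cmod q by rewrite ler_wpM2r// ltW.
have h2 : 2^-1 * cmod q <= cmod (q - p) by lra.
have y0 : 0 <= y by rewrite -(pmulr_lge0 _ cq) (le_trans _ pq)// cmod_ge0.
rewrite cmodM cmodV ler_pdivrMr; last by apply: lt_le_trans h2; rewrite mulr_gt0.
have := ler_wpM2l y0 h2; lra.
Qed.

(** The rational function [z ^+ N / (z ^+ N - rho ^+ N)] is close to 0 inside
    and to 1 outside the circle of radius [rho]; its poles are moved along this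
    circle to [zeta0], then to infinity through the gap of [K] at [zeta0]. *)
Lemma separating_poly K zeta0 (delta c a b e : R) :
  cmod zeta0 = 1 -> 0 < delta ->
  (forall z, K z -> cmod z = 1 /\ delta <= cmod (z - zeta0)) ->
  0 <= c -> c < a -> 0 < e ->
  exists chi : {poly R[i]},
    (forall z, cmod z <= c -> cmod chi.[z] <= e) /\
    (forall r z, a <= r -> r <= b -> K z -> cmod (1 - chi.[r%:C * z]) <= e).
Proof.
move=> z01 delta0 KP c0 ca e0.
have a0 : 0 < a := le_lt_trans c0 ca.
pose rho := (c + a) / 2.
have crho : c < rho by rewrite /rho; lra.
have rhoa : rho < a by rewrite /rho; lra.
have rho0 : 0 < rho := le_lt_trans c0 crho.
pose E : set R[i] := [set z | cmod z <= c \/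
  exists r w, [/\ a <= r, r <= b, K w & z = r%:C * w]].
pose M := c + `|b|.
have M0 : 0 <= M by rewrite addr_ge0.
have EM z : E z -> cmod z <= M.
  case=> [|[r [w [ar rb /KP[w1 _] ->]]]]; first by have := normr_ge0 b; rewrite /M; lra.
  rewrite cmodM w1 mulr1 cmod_real ger0_norm; last by lra.
  by have := ler_norm b; rewrite /M; lra.
pose d := Num.min (Num.min (rho - c) (a - rho)) (a * delta / 2).
have d0 : 0 < d by rewrite !lt_min !subr_gt0 crho rhoa divr_gt0// mulr_gt0.
have [d1 d2 d3] : [/\ d <= rho - c, d <= a - rho & d <= a * delta / 2].
  by split; rewrite /d !ge_min lexx ?orbT.
have dcirc w z : cmod w = rho -> E z -> d <= cmod (z - w).
  move=> wrho [zc|[r [x [ar rb /KP[x1 _] ->]]]].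
    by have := lerB_cmod w z; rewrite cmodBC; lra.
  have := lerB_cmod (r%:C * x) w; rewrite cmodM x1 mulr1 cmod_real ger0_norm; lra.
have dray t z : rho <= t -> E z -> d <= cmod (z - t%:C * zeta0).
  move=> rt [zc|[r [x [ar rb /KP[x1 dx] ->]]]].
    have := lerB_cmod (t%:C * zeta0) z.
    by rewrite cmodBC cmodM z01 mulr1 cmod_real ger0_norm; lra.
  apply: le_trans (dist_ray_ge x1 z01 _ _ dx); [|lra|lra].
  rewrite (le_trans d3)// ler_wpM2r ?invr_ge0// ler_wpM2r// ltW//.
have pole := approx_pole_circle M0 EM z01 d0 rho0 dcirc
   (approx_pole_ray M0 EM z01 d0 (ltW rho0) dray).
(* [x ^+ N] bounds both [(c / rho) ^+ N] and [(rho / a) ^+ N] *)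
pose x := Num.max (c / rho) (rho / a).
have x0 : 0 <= x by rewrite le_max divr_ge0// ltW.
have x1 : x < 1 by rewrite gt_max; apply/andP; split; rewrite ltr_pdivrMr// mul1r.
have e4 : 0 < Num.min 2^-1 (e / 4) by rewrite lt_min invr_gt0 ltr0n divr_gt0.
have [N] := expr_small x0 x1 e4; rewrite le_min => /andP[xN2 xNe].
have N0 : (0 < N)%N.
  by case: N xN2 {xNe} => //; rewrite expr0 => h; exfalso; lra.
set y := x ^+ N in xN2 xNe.
pose p : {poly R[i]} := 'X^N - (rho%:C ^+ N)%:P.
have [rs] := closed_field_poly_normal p.
rewrite (monicP _) ?monicXnsubC// scale1r => pE.
have pz z : p.[z] = z ^+ N - rho%:C ^+ N by rewrite /p !hornerE.
have ua : poly_approx E (fun z => z ^+ N * \prod_(w <- rs) (z - w)^-1).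
  apply: (approx_mul M0 EM).
    by apply: (approx_exp M0 EM); exact: approx_id.
  apply: (approx_prod M0 EM) => w wrs; apply: pole.
  have : root p w by rewrite pE root_prod_XsubC.
  rewrite rootE pz subr_eq0 => /eqP/(congr1 (@cmod R)).
  rewrite !cmodX cmod_real gtr0_norm// => /eqP.
  by rewrite eqrXn2 ?cmod_ge0 ?ltW// => /eqP.
have e2 : 0 < e / 2 by rewrite divr_gt0.
have [chi chiP] := ua _ e2; exists chi.
have uE z : z ^+ N * \prod_(w <- rs) (z - w)^-1 = z ^+ N / (z ^+ N - rho%:C ^+ N).
  rewrite prodfV -pz pE horner_prod; congr (_ / _).
  by apply: eq_bigr => w _; rewrite hornerXsubC.
have yrho (s t : R) : 0 <= s -> 0 < t -> s / t <= x -> s ^+ N <= y * t ^+ N.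
  move=> s0 t0 stx; rewrite -ler_pdivrMr ?exprn_gt0// -expr_div_n.
  by apply: lerXn2r; rewrite // nnegrE divr_ge0// ltW.
split=> [z zc|r z ar rb Kz].
  have := chiP z (or_introl zc); rewrite uE.
  have : cmod (z ^+ N / (rho%:C ^+ N - z ^+ N)) <= 2 * y.
    apply: cmod_quotient => //.
      by rewrite expf_neq0// -cmod_gt0 cmod_real gtr0_norm.
    rewrite !cmodX cmod_real gtr0_norm//; apply: yrho; rewrite ?cmod_ge0//.
    by rewrite le_max ler_wpM2r// invr_ge0 ltW.
  rewrite -opprB invrN mulrN cmodN => h1.
  set U := _ / _ in h1 *; have := cmodB_le U (U - chi.[z]).
  by rewrite subKr; lra.
have [z1 dz] := KP _ Kz; have r0 : 0 < r by lra.
have := chiP (r%:C * z) (or_intror (ex_intro _ r (ex_intro _ z (And4 ar rb Kz erefl)))).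
rewrite uE; set Z := r%:C * z.
have Zr : cmod Z = r by rewrite cmodM z1 mulr1 cmod_real gtr0_norm.
have Z0 : Z ^+ N != 0 by rewrite expf_neq0// -cmod_gt0 Zr.
have h1 : cmod (rho%:C ^+ N / (Z ^+ N - rho%:C ^+ N)) <= 2 * y.
  apply: cmod_quotient => //.
  rewrite !cmodX cmod_real gtr0_norm// Zr; apply: yrho; rewrite ?(ltW rho0)//.
  rewrite le_max; apply/orP; right; rewrite ler_wpM2l ?(ltW rho0)//.
  by rewrite lef_pV2 ?posrE.
have Zrho : Z ^+ N - rho%:C ^+ N != 0.
  rewrite subr_eq0; apply: contraTneq rhoa => /(congr1 (@cmod R)).
  rewrite !cmodX Zr cmod_real gtr0_norm// => /eqP.
  by rewrite eqrXn2 ?ltW// => /eqP <-; rewrite -leNgt.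
have -> : Z ^+ N / (Z ^+ N - rho%:C ^+ N) = 1 + rho%:C ^+ N / (Z ^+ N - rho%:C ^+ N).
  by field.
set U := _ / (_ - _) in h1 *; have := cmodB_le (1 + U - chi.[Z]) U.
have -> : 1 + U - chi.[Z] - U = 1 - chi.[Z] by ring.
by lra.
Qed.

End Separation.

(** * Approximation on proper compact subsets of the circle *)

Section CircleApproximation.
Variable R : realType.
Implicit Types (K : set R[i]) (z w k zeta : R[i]) (h : R[i] -> R[i]).

(** The pole at 0 escapes to infinity through the gap of [K] at [zeta0]. *)
Lemma approx_inv_circle K zeta0 (delta : R) : cmod zeta0 = 1 -> 0 < delta ->
  (forall z, K z -> cmod z = 1 /\ delta <= cmod (z - zeta0)) ->
  poly_approx K (fun z => z^-1).
Proof.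
move=> z01 d0 KP.
have EM z : K z -> cmod z <= 1 by move=> /KP[-> _].
have d2 : 0 < delta / 2 by rewrite divr_gt0.
have dray t z : 0 <= t -> K z -> delta / 2 <= cmod (z - t%:C * zeta0).
  move=> t0 /KP[z1 dz]; have := dist_ray_ge z1 z01 ler01 t0 dz.
  by rewrite mul1r rmorph1 mul1r.
apply: approx_ext (approx_pole_ray ler01 EM z01 d2 (lexx 0) dray) => z _.
by rewrite rmorph0 mul0r subr0.
Qed.

(** On the unit circle the weight [1 - |z - k| ^+ 2 / 4], which peaks at [k], is
    a polynomial in [z] and [1 / z]. *)
Lemma peak_weightE z k : cmod z = 1 -> cmod k = 1 ->
  (1 - cmod (z - k) ^+ 2 / 4)%:C = (2 + k^-1 * z + k * z^-1) / 4.
Proof.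
move=> z1 k1.
have inv_conj x : cmod x = 1 -> Num.conj x = x^-1.
  move=> x1; have x0 : x != 0 by rewrite -cmod_gt0 x1.
  by apply: (mulfI x0); rewrite -normCK divff// cmodE x1 expr1n.
have z0 : z != 0 by rewrite -cmod_gt0 z1.
have k0 : k != 0 by rewrite -cmod_gt0 k1.
rewrite rmorphB rmorphM rmorphXn /= -cmodE normCK rmorphB /= !inv_conj//.
rewrite fmorphV /= rmorph1 rmorph_nat.
by field; rewrite z0 k0.
Qed.

(** The function [h] is approached by the averages
    [(\sum_k h k * phi k z) / (\sum_k phi k z)] over a finite net of [K], where
    [phi k] is the [n]-th power of the weight peaking at [k]. The denominator
    [S] is real and bounded away from 0, so its inverse is approximable by a
    geometric series. *)
Lemma approx_uniform_continuous K zeta0 (delta : R) h :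
  cmod zeta0 = 1 -> 0 < delta ->
  (forall z, K z -> cmod z = 1 /\ delta <= cmod (z - zeta0)) ->
  (forall e : R, 0 < e -> exists2 eta : R, 0 < eta & forall z w, K z -> K w ->
     cmod (z - w) < eta -> cmod (h z - h w) <= e) ->
  (forall eta : R, 0 < eta -> exists s : seq R[i], (forall k, k \in s -> K k) /\
     forall z, K z -> exists2 k, k \in s & cmod (z - k) < eta) ->
  poly_approx K h.
Proof.
move=> z01 d0 KP hu net.
have EM z : K z -> cmod z <= 1 by move=> /KP[-> _].
have [/eqP K0|/set0P[x0 Kx0]] := boolP (K == set0).
  by move=> e e0; exists 0 => z; rewrite K0.
have [B B0 hB] : exists2 B : R, 0 <= B & forall z, K z -> cmod (h z) <= B.
  have [eta eta0 hP] := hu _ ltr01; have [s [sK sP]] := net _ eta0.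
  exists (\sum_(k <- s) cmod (h k) + 1).
    by rewrite addr_ge0// sumr_ge0// => k _; exact: cmod_ge0.
  move=> z Kz; have [k ks zk] := sP _ Kz.
  have := hP _ _ Kz (sK _ ks) zk; have := lerB_cmod (h z) (h k).
  suff : cmod (h k) <= \sum_(k <- s) cmod (h k) by lra.
  rewrite (big_rem k)//= lerDl sumr_ge0// => k' _; exact: cmod_ge0.
apply: approx_lim => e e0.
have e2 : 0 < e / 2 by rewrite divr_gt0.
have [eta' eta'0 hP'] := hu _ e2.
pose eta := Num.min eta' 1.
have eta0 : 0 < eta by rewrite lt_min eta'0 ltr01.
have eta1 : eta <= 1 by rewrite /eta ge_min lexx orbT.
have hP z w : K z -> K w -> cmod (z - w) < eta -> cmod (h z - h w) <= e / 2.
  by move=> Kz Kw; rewrite lt_min => /andP[zw _]; exact: hP'.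
have [|s [sK sP]] := net (eta / 2); first by rewrite divr_gt0.
pose psi k z : R := 1 - cmod (z - k) ^+ 2 / 4.
have psi1 k z : psi k z <= 1.
  by rewrite /psi lerBlDr lerDl divr_ge0 ?sqr_ge0.
have psi0 k z : K k -> K z -> 0 <= psi k z.
  move=> /KP[k1 _] /KP[z1 _]; rewrite /psi subr_ge0 ler_pdivrMr// mul1r.
  have := cmodB_le z k; rewrite k1 z1 => zk.
  have : cmod (z - k) ^+ 2 <= 2 ^+ 2.
    by apply: lerXn2r => //; rewrite nnegrE ?cmod_ge0.
  by rewrite expr2 => /le_trans; apply; lra.
(* Away from [k] the weight is at most [tau], while for a nearest point [k] of
   the net it is at least [tau' > tau]; [n] makes the ratio of the [n]-th powers
   small. *)
pose tau := 1 - eta ^+ 2 / 4; pose tau' := 1 - (eta / 2) ^+ 2 / 4.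
have etasq : 0 < eta ^+ 2 by rewrite exprn_gt0.
have eta_sq1 : eta ^+ 2 <= 1 by rewrite exprn_ile1// ltW.
have tau_ge0 : 0 <= tau by rewrite /tau; lra.
have tau'_gt0 : 0 < tau' by rewrite /tau' expr_div_n; lra.
have tautau' : tau < tau' by rewrite /tau /tau' expr_div_n; lra.
have far k z : eta <= cmod (z - k) -> psi k z <= tau.
  move=> zk; rewrite /psi /tau lerB// ler_wpM2r ?invr_ge0//.
  by apply: lerXn2r => //; rewrite nnegrE ?cmod_ge0 ?ltW.
have close k z : cmod (z - k) < eta / 2 -> tau' <= psi k z.
  move=> zk; rewrite /psi /tau' lerB// ler_wpM2r ?invr_ge0//.
  apply: lerXn2r; rewrite ?nnegrE ?cmod_ge0 ?divr_ge0 ?(ltW eta0)//.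
  exact: ltW.
have q0 : 0 <= tau / tau' by rewrite divr_ge0// ltW.
have q1 : tau / tau' < 1 by rewrite ltr_pdivrMr// mul1r.
pose J : R := (size s)%:R.
have J0 : 0 < J.
  by have [k ks _] := sP _ Kx0; rewrite /J ltr0n; case: s ks {sK sP J}.
have JE : J = (size s)%:R by [].
clearbody J.
have eJ : 0 < e / 2 / (J * (2 * B + 1)).
  by rewrite divr_gt0// mulr_gt0// ltr_wpDl// mulr_ge0.
have [n nP] := expr_small q0 q1 eJ.
pose phi k z : R := psi k z ^+ n.
pose S z : R := \sum_(k <- s) phi k z.
have phi0 k z : K k -> K z -> 0 <= phi k z by move=> ? ?; rewrite exprn_ge0 ?psi0.
pose m := tau' ^+ n.
have m0 : 0 < m by rewrite exprn_gt0.
have Sm z : K z -> m <= S z.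
  move=> Kz; have [k ks zk] := sP _ Kz; rewrite /S (big_rem k)//=.
  apply: (@le_trans _ _ (phi k z)).
    by apply: lerXn2r; rewrite ?nnegrE ?(ltW tau'_gt0) ?psi0 ?close//; exact: sK.
  rewrite lerDl big_seq sumr_ge0// => k' /mem_rem /sK Kk'; exact: phi0.
have SJ z : K z -> S z <= J.
  move=> Kz; rewrite /S JE -sum1_size natr_sum big_seq [leRHS]big_seq.
  by apply: ler_sum => k /sK Kk; rewrite exprn_ile1 ?psi0.
have mJ : m <= J := le_trans (Sm _ Kx0) (SJ _ Kx0).
have phia k : k \in s -> poly_approx K (fun z => (phi k z)%:C).
  move=> /sK Kk; have [k1 _] := KP _ Kk.
  have base : poly_approx K (fun z => (2 + k^-1 * z + k * z^-1) * 4^-1).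
    apply: (approx_mul ler01 EM); last exact: approx_cst.
    apply: approx_add.
      apply: approx_add; first exact: approx_cst.
      by apply: (approx_mul ler01 EM); [exact: approx_cst|exact: approx_id].
    apply: (approx_mul ler01 EM); first exact: approx_cst.
    exact: approx_inv_circle z01 d0 KP.
  apply: approx_ext (approx_exp ler01 EM n base) => z Kz.
  by rewrite /phi rmorphXn /= -peak_weightE//; have [] := KP _ Kz.
have sum_approx (c : R[i] -> R[i]) :
    poly_approx K (fun z => \sum_(k <- s) c k * (phi k z)%:C).
  elim: (s) phia => [|k r IH] pa.
    by apply: approx_ext (approx_cst K 0) => z _; rewrite big_nil.
  have h1 := approx_mul ler01 EM (approx_cst K (c k)) (pa k (mem_head _ _)).
  have h2 := IH (fun j jr => pa j (mem_behead (s := k :: r) jr)).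
  by apply: approx_ext (approx_add h1 h2) => z _; rewrite big_cons.
have Sa : poly_approx K (fun z => (S z)%:C).
  apply: approx_ext (sum_approx (fun=> 1)) => z _.
  by rewrite rmorph_sum; apply: eq_bigr => k _; rewrite mul1r.
have Sinv : poly_approx K (fun z => (S z)%:C^-1).
  pose v z := 1 + (- J^-1)%:C * (S z)%:C.
  have va : poly_approx K v.
    apply: approx_add; first exact: approx_cst.
    by apply: (approx_mul ler01 EM) => //; exact: approx_cst.
  have vle z : K z -> cmod (v z) <= 1 - m / J.
    move=> Kz; have -> : v z = (1 - S z / J)%:C.
      by rewrite /v rmorphB rmorphN !rmorphM /= rmorph1 mulNr mulrC.
    rewrite cmod_real ger0_norm.
      by rewrite lerB// ler_wpM2r ?Sm// invr_ge0 ltW.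
    by rewrite subr_ge0 ler_pdivrMr// mul1r SJ.
  have mJ1 : 1 - m / J < 1 by rewrite ltrBlDr ltrDl divr_gt0.
  have ga := approx_geometric ler01 EM mJ1 vle va.
  apply: approx_ext (approx_mul ler01 EM (approx_cst K (J^-1)%:C) ga) => z Kz.
  have S0 : (S z)%:C != 0 :> R[i].
    by rewrite -cmod_gt0 cmod_real normr_gt0 gt_eqF// (lt_le_trans m0)// Sm.
  have Jn0 : J%:C != 0 :> R[i] by rewrite -cmod_gt0 cmod_real normr_gt0 gt_eqF.
  have -> : 1 - v z = (S z)%:C / J%:C.
    by rewrite /v rmorphN fmorphV /=; field.
  by rewrite fmorphV /=; field; rewrite S0 Jn0.
exists (fun z => (\sum_(k <- s) h k * (phi k z)%:C) * (S z)%:C^-1).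
  exact: (approx_mul ler01 EM).
move=> z Kz; have Sz0 : 0 < S z by rewrite (lt_le_trans m0)// Sm.
have S0 : (S z)%:C != 0 :> R[i] by rewrite -cmod_gt0 cmod_real normr_gt0 gt_eqF.
have -> : h z - (\sum_(k <- s) h k * (phi k z)%:C) / (S z)%:C =
    (\sum_(k <- s) (h z - h k) * (phi k z)%:C) / (S z)%:C.
  apply: (mulIf S0); rewrite divfK// mulrBl divfK// rmorph_sum mulr_sumr -sumrB.
  by apply: eq_bigr => k _; rewrite mulrBl.
rewrite cmodM cmodV cmod_real (gtr0_norm Sz0) ler_pdivrMr//.
apply: le_trans (cmod_sum _ _) _.
apply: (@le_trans _ _ (\sum_(k <- s) (e / 2 * phi k z + 2 * B * tau ^+ n))).
  rewrite big_seq [leRHS]big_seq; apply: ler_sum => k /sK Kk.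
  rewrite cmodM cmod_real (ger0_norm (phi0 _ _ Kk Kz)).
  (* near points contribute by continuity of [h], far ones by smallness of [phi] *)
  have [zk|zk] := ltP (cmod (z - k)) eta.
    rewrite -[leLHS]addr0 lerD ?mulr_ge0 ?exprn_ge0//.
    by rewrite ler_wpM2r ?phi0 ?hP.
  rewrite -[leLHS]add0r; apply: lerD.
    by apply: mulr_ge0; [exact: ltW|exact: phi0].
  apply: ler_pM; rewrite ?cmod_ge0 ?phi0//.
    by have := cmodB_le (h z) (h k); have := hB _ Kz; have := hB _ Kk; lra.
  by apply: lerXn2r; rewrite ?nnegrE ?psi0 ?far.
rewrite big_split /= -mulr_sumr -/(S z).
have -> : \sum_(k <- s) 2 * B * tau ^+ n = J * (2 * B * tau ^+ n).
  by rewrite JE big_const_seq count_predT iter_addr_0 [RHS]mulr_natl.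

(* the far points of the net contribute at most half of [e * S z] *)
suff : J * (2 * B * tau ^+ n) <= e / 2 * m by have := Sm _ Kz; nra.
move: nP; rewrite ler_pdivlMr; last by rewrite mulr_gt0// ltr_wpDl// mulr_ge0.
rewrite expr_div_n mulrAC ler_pdivrMr ?exprn_gt0// => /(le_trans _); apply.
by have := mulr_ge0 (ltW J0) (exprn_ge0 n tau_ge0); lra.
Qed.

End CircleApproximation.

(** * Consequences of compactness *)

Section Compactness.
Variable R : realType.
Implicit Types (K : set R[i]) (z w k zeta : R[i]) (h : R[i] -> R[i]).

Lemma closed_cmod_le (f : R[i] -> R) (a : R) : continuous f ->
  closed [set z | f z <= a].
Proof.
move=> fc; have -> : [set z | f z <= a] = f @^-1` [set x | x <= a] by [].
by apply: preimage_closed => //; exact: closed_le.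
Qed.

(** A compact subset of the circle with connected complement misses an arc: if it
    were the whole circle, the open disc would be a nonempty proper clopen subset
    of its complement. *)
Lemma compact_gap K : compact K -> K `<=` unit_circle R -> connected (~` K) ->
  exists zeta0 (delta : R), [/\ cmod zeta0 = 1, 0 < delta &
    forall z, K z -> cmod z = 1 /\ delta <= cmod (z - zeta0)].
Proof.
move=> cK KT connK; have [[zeta0 z01 nK]|] := pselect (exists2 z, cmod z = 1 & ~ K z).
  have /compact_closed - /(_ _ cK) : hausdorff_space R[i] by exact: norm_hausdorff.
  rewrite -openC openE => /(_ _ nK)/nbhs_cmodP[d d0 dK].
  exists zeta0, d; split=> // z Kz; split; first exact: KT.
  by rewrite leNgt; apply/negP => /dK.
move=> nex; exfalso; have KE z : K z <-> cmod z = 1.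
  split=> [/KT//|z1]; apply: contrapT => nK; apply: nex; by exists z.
have : ~` K `&` [set z | cmod z <= 2^-1 + 2^-1] = ~` K.
  apply: connK.
  - by exists 0; split=> /=; rewrite ?KE cmod0; [move=> h; lra | lra].
  - exists [set z | cmod z < 1].
      have -> : [set z : R[i] | cmod z < 1] = (@cmod R) @^-1` [set x | x < 1] by [].
      by apply: open_comp; [move=> z _; exact: cmod_continuous|exact: open_lt].
    apply/seteqP; split=> z [nKz] /= zle; split=> //; last by lra.
    by rewrite lt_def; apply/andP; split; [apply/eqP => z1; apply: nKz; rewrite KE|lra].
  - exists [set z | cmod z <= 2^-1 + 2^-1] => //.
    by apply: closed_cmod_le; exact: cmod_continuous.
move=> /seteqP[_ /(_ 2%:R%:C)] /=; rewrite KE cmod_real normr_nat => h.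
by have [|_] := h _; lra.
Qed.

Lemma compact_net K : compact K -> forall eta : R, 0 < eta ->
  exists s : seq R[i], (forall k, k \in s -> K k) /\
     forall z, K z -> exists2 k, k \in s & cmod (z - k) < eta.
Proof.
move=> cK eta eta0; move: cK; rewrite compact_cover => cK.
have [||D DK KD] := cK R[i] K (fun k => [set z | cmod (z - k) < eta]).
- move=> k _; rewrite openE => z /= zk; apply/nbhs_cmodP.
  exists (eta - cmod (z - k)); first by rewrite subr_gt0.
  by move=> w wz /=; have := cmod_dist_le w k z; lra.
- by move=> z Kz; exists z => //=; rewrite subrr cmod0.
exists (finmap.enum_fset D); split=> [k kD|z /KD[k /= kD zk]]; last by exists k.
by apply: set_mem; apply: DK.
Qed.

Lemma compact_uniform_continuous K h : compact K -> {within K, continuous h} ->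
  forall e : R, 0 < e -> exists2 eta : R, 0 < eta & forall z w, K z -> K w ->
     cmod (z - w) < eta -> cmod (h z - h w) <= e.
Proof.
move=> cK /subspace_continuousP hc e e0; have e2 : 0 < e / 2 by rewrite divr_gt0.
pose P (d : R) (z : R[i]) := K z -> forall w, K w -> cmod (z - w) < d ->
  cmod (h z - h w) <= e.
have : \forall d \near nbhs (0 : R), K `<=` P d.
  apply: (compact_near_coveringP K).1 => // z Kz.
  have : nbhs (h z) [set y | cmod (y - h z) < e / 2].
    by apply/nbhs_cmodP; exists (e / 2).
  move=> /(hc z Kz); rewrite /= /within /= => /nbhs_cmodP[d d0 dP].
  exists ([set w | cmod (w - z) < d / 2], [set x | `|x| < d / 2]) => /=.
    split; first by apply/nbhs_cmodP; exists (d / 2); rewrite ?divr_gt0.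
    apply/nbhs_ballP; exists (d / 2); first by rewrite /= divr_gt0.
    by move=> y; rewrite -ball_normE /= sub0r normrN.
  move=> [w x] /= [wz xd] Kw w' Kw' ww'.
  have h1 : cmod (h w - h z) < e / 2 by apply: dP => //; lra.
  have h2 : cmod (h w' - h z) < e / 2.
    apply: dP => //; have := cmod_dist_le w' z w; rewrite (cmodBC w' w).
    by have := ler_norm x; lra.
  have := cmod_dist_le (h w) (h w') (h z); rewrite (cmodBC (h z)); lra.
move=> /nbhs_ballP[d /= d0 dP]; exists (d / 2); first by rewrite divr_gt0.
move=> z w Kz Kw zw; apply: (dP (d / 2)) => //.
by rewrite -ball_normE /= sub0r normrN ger0_norm ?divr_ge0 ?ltW//; lra.
Qed.

Lemma approx_continuous K (cK : compact K) zeta0 (delta : R)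
    (h : continuous_on_compact cK) :
  cmod zeta0 = 1 -> 0 < delta ->
  (forall z, K z -> cmod z = 1 /\ delta <= cmod (z - zeta0)) ->
  forall e : R, 0 < e -> exists q : {poly R[i]},
    forall x : set_type K, cmod (h x - q.[val x]) <= e.
Proof.
move=> z01 d0 KP e e0.
pose H : R[i] -> R[i] := 'valL_(0 : R[i]) (h : set_type K -> R[i]).
have HE : sigL K H = h.
  by rewrite -[LHS]/((sigL K \o 'valL_(0 : R[i])) (h : K -> R[i])) sigL_valL.
have Hc : {within K, continuous H}.
  by apply/subspace_sigL_continuousP; rewrite HE; exact: cts_fun.
have [q qP] := approx_uniform_continuous z01 d0 KP
  (compact_uniform_continuous cK Hc) (compact_net cK) e0.
by exists q => x; rewrite -HE; apply: qP; apply: set_mem; exact: valP.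
Qed.

Lemma closed_disc_compact (x : R) : compact (closed_disc x).
Proof.
pose f (p : R * R) : R[i] := p.1%:C + 'i * p.2%:C.
have fc : continuous f.
  apply: ctsD; last apply: ctsZ; move=> p; apply: continuous_comp.
  - exact: cvg_fst.
  - exact: continuous_RtoC.
  - exact: cvg_snd.
  - exact: continuous_RtoC.
apply: (@subclosed_compact _ _ (f @` (`[- x, x] `*` `[- x, x]))).
- by apply: closed_cmod_le; exact: cmod_continuous.
- apply: continuous_compact; first exact: continuous_subspaceT.
  by apply: compact_setX; exact: segment_compact.
move=> z zx; exists (complex.Re z, complex.Im z); last by rewrite /f -complexE.
split; rewrite /= in_itv /= -ler_norml (le_trans _ zx)//.
  exact: cmod_Re.
exact: cmod_Im.
Qed.

Lemma holomorphic_continuous (U : set R[i]) h z :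
  holomorphic_on U h -> U z -> {for z, continuous h}.
Proof. by move=> hU /hU /derivable1_diffP/differentiable_continuous. Qed.

Lemma holomorphic_bounded h (x : R) : holomorphic_on (unit_disc R) h -> x < 1 ->
  exists2 B : R, 0 <= B & forall z, cmod z <= x -> cmod (h z) <= B.
Proof.
move=> hh x1; have hc : {within closed_disc x, continuous (fun z => cmod (h z))}.
  apply/continuous_in_subspaceT => z /set_mem zx.
  apply: continuous_comp; last exact: cmod_continuous.
  by apply: (holomorphic_continuous hh); apply: le_lt_trans x1.
have := continuous_compact hc (closed_disc_compact (x := x)).
move=> /(@compact_bounded R R^o)[M [_ MP]].
exists (Num.max 0 (M + 1)); first by rewrite le_max lexx.
move=> z zx; rewrite le_max; apply/orP; right.
apply: le_trans (ler_norm _) (MP (M + 1) _ _ _); first by rewrite ltrDl.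
by exists z.
Qed.

End Compactness.

(** * Ordering the segments *)

Section Segments.
Variables (R : realType) (T : choiceType) (a b : T -> R).
Hypothesis a_ge0 : forall t, 0 <= a t.
Hypothesis a_le_b : forall t, a t <= b t.
Hypothesis b_lt1 : forall t, b t < 1.
Hypothesis disjoint_ab : trivIset setT (fun t => `[a t, b t]%classic).
Hypothesis finite_ab : locally_finite (fun t => `[a t, b t]%classic).

Lemma finite_left_le x : x < 1 -> finite_set [set t | a t <= x].
Proof.
move=> x1; have x01 : `[0, x] `<=` `[0, 1[%classic.
  by move=> y /=; rewrite !in_itv /= => /andP[-> yx] /=; exact: le_lt_trans x1.
apply: sub_finite_set (finite_ab (segment_compact (a := 0) (b := x)) x01).
by move=> t /= ax; exists (a t); rewrite /= !in_itv /= a_ge0 ax lexx a_le_b.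
Qed.

Lemma segment_order t t' : a t < a t' -> b t < a t'.
Proof.
move=> aa; rewrite ltNge; apply/negP => ab.
have tt' : t = t'.
  apply: (disjoint_ab (i := t) (j := t')) => //; exists (a t').
  by rewrite /= !in_itv /= (ltW aa) ab lexx a_le_b.
by rewrite tt' ltxx in aa.
Qed.

Lemma left_inj : injective a.
Proof.
move=> t t' aa; apply: (disjoint_ab (i := t) (j := t')) => //; exists (a t).
by rewrite /= !in_itv /= lexx a_le_b aa lexx a_le_b.
Qed.

(** The position of a segment in the order of left endpoints. *)
Definition rank t : nat := size (finmap.enum_fset (fset_set [set t' | a t' < a t])).

Lemma finite_left_lt t : finite_set [set t' | a t' < a t].
Proof.
have := finite_left_le (le_lt_trans (a_le_b t) (b_lt1 t)).
by apply: sub_finite_set => t' /=; exact: ltW.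
Qed.

Lemma rank_lt t t' : a t < a t' -> (rank t < rank t')%N.
Proof.
move=> aa; apply: finmap.fproper_ltn_card; rewrite finmap.fproperE.
apply/andP; split.
  apply/finmap.fsubsetP => s; rewrite !in_fset_set; try exact: finite_left_lt.
  by move=> /set_mem /= sa; apply: mem_set; exact: lt_trans aa.
apply/finmap.fsubsetPn; exists t; rewrite in_fset_set; try exact: finite_left_lt.
  exact: mem_set.
by apply/negP => /set_mem /=; rewrite ltxx.
Qed.

Lemma rank_inj : injective rank.
Proof.
move=> t t' rr; apply: left_inj; apply/eqP; rewrite eq_le !leNgt.
by apply/andP; split; apply/negP => /rank_lt; rewrite rr ltnn.
Qed.

(** [rank] is injective, so only finitely many segments precede a given position. *)
Lemma finite_rank_lt k : finite_set [set t | (rank t < k)%N].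
Proof.
apply: (@finite_preimage _ _ `I_k rank) (finite_II k) => t t' _ _.
exact: rank_inj.
Qed.

Lemma finite_rank_bound (S : set T) : finite_set S ->
  exists k, forall t, S t -> (rank t < k)%N.
Proof.
move=> /finite_seqP[s ->]; exists (\max_(t <- s) rank t).+1 => t /= ts.
by rewrite ltnS; apply: leq_bigmax_seq.
Qed.

Lemma finite_right_bound (S : set T) (y x : R) : finite_set S -> y < x ->
  (forall t, S t -> b t < x) ->
  exists c, [/\ y < c, c < x & forall t, S t -> b t < c].
Proof.
move=> /finite_seqP[s ->] yx; elim: s => [|t s IH] sx.
  by exists ((y + x) / 2); split; [lra|lra|].
have [|c [yc cx sc]] := IH; first by move=> u us; apply: sx; rewrite /= in_cons us orbT.
have tx : b t < x by apply: sx; rewrite /= mem_head.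
exists (Num.max c ((b t + x) / 2)); split.
- by rewrite lt_max yc.
- by rewrite gt_max cx; lra.
- move=> u /=; rewrite in_cons lt_max => /orP[/eqP ->|us]; last by rewrite sc.
  by apply/orP; right; lra.
Qed.

(** A radius just below the segment [t] and beyond the earlier ones; the bound
    [2 * a t - 1 < c] makes these radii tend to 1. *)
Lemma radius_before (rho : R) t : rho < a t -> exists c,
  [/\ rho < c, c < a t, 2 * a t - 1 < c & forall t', a t' < a t -> b t' < c].
Proof.
move=> rt; have a1 : a t < 1 := le_lt_trans (a_le_b t) (b_lt1 t).
have [||c [yc cx cb]] := @finite_right_bound _ (Num.max rho (2 * a t - 1)) (a t)
    (finite_left_lt t); first by rewrite gt_max rt; lra.
  by move=> t' /segment_order.
by exists c; move: yc; rewrite gt_max => /andP[? ?].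
Qed.

End Segments.

(** * One correction *)

Section Step.
Variable R : realType.

(** Multiplication by [1 - chi] and addition of [P * chi], where [chi] separates
    the disc of radius [c] from the sector over [[a, b]] and [K]. *)
Lemma correction_step (g : R[i] -> R[i]) (A B P : {poly R[i]}) (K : set R[i])
    zeta0 (delta c a b e : R) :
  holomorphic_on (unit_disc R) g ->
  cmod zeta0 = 1 -> 0 < delta ->
  (forall z, K z -> cmod z = 1 /\ delta <= cmod (z - zeta0)) ->
  0 <= c -> c < a -> a <= b -> b < 1 -> 0 < e ->
  exists A' B' : {poly R[i]},
    (forall z, cmod z <= c -> [/\ cmod (A'.[z] - A.[z]) <= e,
       cmod (B'.[z] - B.[z]) <= e &
       cmod ((g z * A'.[z] + B'.[z]) - (g z * A.[z] + B.[z])) <= e]) /\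
    (forall r z, a <= r -> r <= b -> K z ->
       cmod (g (r%:C * z) * A'.[r%:C * z] + B'.[r%:C * z] - P.[r%:C * z]) <= e).
Proof.
move=> gh z01 d0 KP c0 ca ab b1 e0; have b0 : 0 <= b by lra.
have [G G0 GP] := holomorphic_bounded gh b1.
have [A0 A00 AP] := horner_bounded A b0.
have [B0 B00 BP] := horner_bounded B b0.
have [P0 P00 PP] := horner_bounded P b0.
pose L := 1 + A0 + G * A0 + B0 + P0.
have GA0 : 0 <= G * A0 by rewrite mulr_ge0.
have L0 : 0 < L by rewrite /L; lra.
have eL : 0 < e / L by rewrite divr_gt0.
have [chi [chi1 chi2]] := separating_poly b z01 d0 KP c0 ca eL.
have small x y (m : R) : cmod x <= m -> m <= L -> cmod y <= e / L ->
    cmod (x * y) <= e.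
  move=> xm mL ye; rewrite cmodM -[leRHS](divfK (_ : L != 0)) ?gt_eqF// mulrC.
  by apply: ler_pM; rewrite ?cmod_ge0// (le_trans xm).
have fP z : cmod z <= b -> cmod (g z * A.[z] + B.[z] - P.[z]) <= G * A0 + B0 + P0.
  move=> zb; rewrite (le_trans (cmodB_le _ _))// lerD ?PP//.
  rewrite (le_trans (ler_cmodD _ _))// lerD ?BP// cmodM.
  by apply: ler_pM; rewrite ?cmod_ge0 ?GP ?AP.
exists (A * (1%:P - chi)), (B * (1%:P - chi) + P * chi); split=> [z zc|r z ar rb Kz].
  have zb : cmod z <= b by lra.
  have chiz : cmod (- chi.[z]) <= e / L by rewrite cmodN chi1.
  rewrite !(hornerM, hornerD, hornerN, hornerC); split.
  - rewrite [X in cmod X](_ : _ = A.[z] * - chi.[z]); last by ring.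
    by apply: small chiz; [exact: AP|rewrite /L; lra].
  - rewrite [X in cmod X](_ : _ = (B.[z] - P.[z]) * - chi.[z]); last by ring.
    apply: (small _ _ (B0 + P0)) chiz; last by rewrite /L; lra.
    by rewrite (le_trans (cmodB_le _ _))// lerD ?BP ?PP.
  - rewrite [X in cmod X](_ : _ = (g z * A.[z] + B.[z] - P.[z]) * - chi.[z]);
      last by ring.
    by apply: small chiz; [exact: fP|rewrite /L; lra].
have [z1 _] := KP _ Kz; have r0 : 0 <= r by lra.
set w := r%:C * z; have wb : cmod w <= b by rewrite cmodM z1 mulr1 cmod_real ger0_norm.
rewrite !(hornerM, hornerD, hornerN, hornerC).
rewrite [X in cmod X](_ : _ = (g w * A.[w] + B.[w] - P.[w]) * (1 - chi.[w]));
  last by ring.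
by apply: (small _ _ _ (fP w wb)); [rewrite /L; lra|exact: chi2].
Qed.

End Step.

(** * The inductive construction *)

Section Construction.
Variables (R : realType) (T : choiceType) (a b : T -> R).
Hypothesis a_ge0 : forall t, 0 <= a t.
Hypothesis a_le_b : forall t, a t <= b t.
Hypothesis b_lt1 : forall t, b t < 1.
Hypothesis disjoint_ab : trivIset setT (fun t => `[a t, b t]%classic).
Hypothesis finite_ab : locally_finite (fun t => `[a t, b t]%classic).
Variables (K : T -> set R[i]) (zeta0 : T -> R[i]) (delta : T -> R).
Hypothesis zeta0_circle : forall t, cmod (zeta0 t) = 1.
Hypothesis delta_gt0 : forall t, 0 < delta t.
Hypothesis K_gap : forall t z, K t z ->
  cmod z = 1 /\ delta t <= cmod (z - zeta0 t).
Variables (P : T -> {poly R[i]}) (g : R[i] -> R[i]) (rho e : R).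
Hypothesis g_holomorphic : holomorphic_on (unit_disc R) g.
Hypothesis rho_ge0 : 0 <= rho.
Hypothesis e_gt0 : 0 < e.

Local Notation rank := (rank a).

(** The correction attached to the segment of rank [k] has size [e / 2 ^+ k.+1];
    segments with [a t <= rho] are left aside, so as not to disturb [g] on the
    disc of radius [rho]. The index [k] of the recursion is a rank; if no segment
    to be treated has that rank, nothing is done. *)
Lemma prescribed_on_segments : exists f : R[i] -> R[i],
  [/\ holomorphic_on (unit_disc R) f,
      forall z, cmod z <= rho -> cmod z < 1 -> cmod (f z - g z) <= e &
      forall t r z, rho < a t -> a t <= r -> r <= b t -> K t z ->
        cmod (f (r%:C * z) - (P t).[r%:C * z]) <= e / 2 ^+ rank t].
Proof.
pose C := e / 2.
have C0 : 0 < C by rewrite divr_gt0.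
have /choice[c cP] (t : T) : exists c, rho < a t ->
    [/\ rho < c, c < a t, 2 * a t - 1 < c & forall t', a t' < a t -> b t' < c].
  have [rt|nrt] := pselect (rho < a t); last by exists 0 => rt; case: nrt.
  have [c ?] := radius_before a_ge0 a_le_b b_lt1 disjoint_ab finite_ab rt.
  by exists c => _.
pose v (s : {poly R[i]} * {poly R[i]}) z := g z * s.1.[z] + s.2.[z].
pose good k t (s s' : {poly R[i]} * {poly R[i]}) :=
  (forall z, cmod z <= c t -> [/\ cmod (s'.1.[z] - s.1.[z]) <= C / 2 ^+ k,
     cmod (s'.2.[z] - s.2.[z]) <= C / 2 ^+ k &
     cmod (v s' z - v s z) <= C / 2 ^+ k]) /\
  (forall r z, a t <= r -> r <= b t -> K t z ->
     cmod (v s' (r%:C * z) - (P t).[r%:C * z]) <= C / 2 ^+ k).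
have /choice[F FP] (ks : nat * ({poly R[i]} * {poly R[i]})) :
    exists s', (forall t, rho < a t -> rank t = ks.1 -> good ks.1 t ks.2 s') /\
      ((forall t, rho < a t -> rank t <> ks.1) -> s' = ks.2).
  case: ks => k s /=.
  have [[t [rt tk]]|nt] := pselect (exists t, rho < a t /\ rank t = k); last first.
    exists s; split=> // t rt tk; exfalso; apply: nt; by exists t.
  have [rc ca _ _] := cP _ rt.
  have Ck : 0 < C / 2 ^+ k by rewrite divr_gt0// exprn_gt0.
  have [A' [B' AB]] := correction_step s.1 s.2 (P t) g_holomorphic
    (zeta0_circle t) (delta_gt0 t) (@K_gap t) (ltW (le_lt_trans rho_ge0 rc)) ca
    (a_le_b t) (b_lt1 t) Ck.
  exists (A', B'); split=> [t' rt' tk'|]; last by move=> /(_ t rt).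
  have -> : t' = t.
    apply: (rank_inj a_ge0 a_le_b b_lt1 disjoint_ab finite_ab).
    by rewrite tk tk'.
  exact: AB.
pose s_ := fix s k := if k is k'.+1 then F (k', s k') else (1, 0).
have sP k t : rho < a t -> rank t = k -> good k t (s_ k) (s_ k.+1).
  exact: (FP (k, s_ k)).1.
have stepP k z : (forall t, rho < a t -> rank t = k -> cmod z <= c t) ->
    [/\ cmod ((s_ k.+1).1.[z] - (s_ k).1.[z]) <= C / 2 ^+ k,
     cmod ((s_ k.+1).2.[z] - (s_ k).2.[z]) <= C / 2 ^+ k &
     cmod (v (s_ k.+1) z - v (s_ k) z) <= C / 2 ^+ k].
  move=> zc; have [[t [rt tk]]|nt] := pselect (exists t, rho < a t /\ rank t = k).
    exact: (sP k t rt tk).1 _ (zc t rt tk).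
  have -> : s_ k.+1 = s_ k.
    by apply: (FP (k, s_ k)).2 => t rt tk; apply: nt; exists t.
  by rewrite !subrr cmod0 divr_ge0 ?exprn_ge0 ?ltW.
(* from some rank on, the radii [c t] exceed [x] *)
have locally x : x < 1 -> exists k0, forall k, (k0 <= k)%N -> forall z, cmod z <= x ->
    forall t, rho < a t -> rank t = k -> cmod z <= c t.
  move=> x1; have [|k0 k0P] := finite_rank_bound a (S := [set t | a t <= (x + 1) / 2]).
    by apply: (finite_left_le a_ge0 a_le_b finite_ab); lra.
  exists k0 => k k0k z zx t rt tk; have [_ _ ac _] := cP _ rt.
  have [ax|] := leP (a t) ((x + 1) / 2); last by lra.
  by have := k0P t ax; rewrite tk ltnNge k0k.
have [|A Ah AP] := @poly_limit R (fun k => (s_ k).1) C (ltW C0).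
  move=> x /locally[k0 k0P]; exists k0 => k k0k z zx.
  by have [] := stepP k z (k0P k k0k z zx).
have [|B Bh BP] := @poly_limit R (fun k => (s_ k).2) C (ltW C0).
  move=> x /locally[k0 k0P]; exists k0 => k k0k z zx.
  by have [] := stepP k z (k0P k k0k z zx).
pose f z := g z * A z + B z.
have flim z w (D : R) j0 : unit_disc R z ->
    (forall j, (j0 <= j)%N -> cmod (v (s_ j) z - w) <= D) -> cmod (f z - w) <= D.
  move=> z1 vD; apply/ler_addgt0Pr => eta eta0.
  have e1 : 0 < eta / 2 / (cmod (g z) + 1).
    by rewrite !divr_gt0// ltr_wpDl// cmod_ge0.
  have e2 : 0 < eta / 2 by rewrite divr_gt0.
  have [j1 j1P] := AP z z1 _ e1; have [j2 j2P] := BP z z1 _ e2.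
  pose j := (j0 + j1 + j2)%N.
  have h0 : (j0 <= j)%N by rewrite /j -addnA leq_addr.
  have h1 : (j1 <= j)%N by rewrite /j -addnA addnCA leq_addr.
  have h2 : (j2 <= j)%N by rewrite /j leq_addl.
  have := vD j h0; have := j2P j h2; have := j1P j h1.
  rewrite ler_pdivlMr; last by rewrite ltr_wpDl// cmod_ge0.
  move=> d1 d2 d3; have -> : f z - w = g z * (A z - (s_ j).1.[z]) +
     (B z - (s_ j).2.[z]) + (v (s_ j) z - w) by rewrite /f /v; ring.
  have := ler_cmodD (g z * (A z - (s_ j).1.[z]) + (B z - (s_ j).2.[z]))
    (v (s_ j) z - w).
  have := ler_cmodD (g z * (A z - (s_ j).1.[z])) (B z - (s_ j).2.[z]).
  rewrite cmodM; have := cmod_ge0 (A z - (s_ j).1.[z]); have := cmod_ge0 (g z).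
  by nra.
exists f; split.
- move=> z z1; apply: derivableD; last exact: Bh.
  by apply: derivableM; [exact: g_holomorphic|exact: Ah].
- move=> z zrho z1; apply: (flim z _ _ 0%N) => // j _.
  have -> : g z = v (s_ 0%N) z by rewrite /v /= hornerC horner0 mulr1 addr0.
  have := geometric_telescope (u := fun j => v (s_ j) z) (k0 := 0%N) (ltW C0) _
    (leqnn _) (leq0n j).
  rewrite (_ : 2 * C / 2 ^+ 0 = e); last by rewrite /C expr0; field.
  apply => k _.
  have [] // := stepP k z _ => t rt _; have [rc _ _ _] := cP _ rt; lra.
move=> t r z rt ar rb Kz; have [z1 _] := K_gap Kz.
set w := r%:C * z; set k := rank t.
have r0 : 0 <= r by apply: le_trans (a_ge0 t) ar.
have wr : cmod w = r by rewrite cmodM z1 mulr1 cmod_real ger0_norm.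
have w1 : unit_disc R w by rewrite /unit_disc /= wr (le_lt_trans rb).
have hk := (sP k t rt erefl).2 r z ar rb Kz.
apply: (flim w _ _ k.+1) => // j kj.
(* later corrections are small at [w], as their discs contain it *)
have later i : (k.+1 <= i)%N -> cmod (v (s_ i.+1) w - v (s_ i) w) <= C / 2 ^+ i.
  move=> ki; have [] // := stepP i w _ => t' rt' ti.
  have [_ _ _ bc] := cP _ rt'; rewrite wr (le_trans rb)// ltW// bc//.
  rewrite ltNge le_eqVlt; apply/negP => /orP[/eqP|].
    move=> /(left_inj a_le_b disjoint_ab) tt'; move: ki.
    by rewrite -ti tt' ltnn.
  move=> /(rank_lt a_ge0 a_le_b b_lt1 finite_ab).
  by rewrite ti -/k => ik; move: (ltn_trans ki ik); rewrite ltnn.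
have := geometric_telescope (u := fun j => v (s_ j) w) (ltW C0) later (leqnn _) kj.
have := cmod_dist_le (v (s_ j) w) (P t).[w] (v (s_ k.+1) w).
rewrite -/w in hk; have -> : e / 2 ^+ k = 2 * C / 2 ^+ k.+1 + C / 2 ^+ k.
  by rewrite exprS /C; field; rewrite expf_neq0// pnatr_eq0.
lra.
Qed.

End Construction.

(** * Holomorphic functions prescribed along dilations *)

Theorem proposition6p1 (R : realType)
  (K : nat -> set R[i])
  (K_compact : forall l, compact (K l))
  (K_circle : forall l, K l `<=` unit_circle R)
  (K_connected : forall l, connected (~` K l))
  (K_cofinal : forall L : set R[i], compact L -> L `<=` unit_circle R ->
     L <> unit_circle R -> exists l, L `<=` K l)
  (V : forall l : nat, nat -> set (continuous_on_compact (K_compact l)))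
  (V_ball : forall l n, open_ball (V l n))
  (V_basis : forall l, basis (range (V l)))
  (Gamma : nat * nat * nat -> set R)
  (Gamma_segment : forall t, segment (Gamma t))
  (Gamma_sub : forall t, Gamma t `<=` `[0, 1[%classic)
  (Gamma_disjoint : trivIset setT Gamma)
  (Gamma_locally_finite : locally_finite Gamma)
  (eps : R) (eps_gt0 : 0 < eps)
  (g : R[i] -> R[i]) (g_holomorphic : holomorphic_on (unit_disc R) g)
  (rho : R) (rho_ge0 : 0 <= rho)
  (D_sub : closed_disc rho `<=` unit_disc R) :
  exists (r_ : nat -> nat -> R) (f : R[i] -> R[i]),
    [/\ forall l n, `[0, 1[%classic (r_ l n),
        holomorphic_on (unit_disc R) f,
        (sup_on (closed_disc rho) (f \- g)%R < eps%:E)%E &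
        forall (l n : nat) (r : R),
          ((\bigcup_(m in [set: nat]) Gamma (l, n, m)) `&` `[r_ l n, 1[) r ->
          restriction_in (f \o dilation r) (V l n)].
Proof.
have /choice[a /choice[b abP]] : forall t, exists a b : R,
    a <= b /\ Gamma t = `[a, b]%classic.
  by move=> t; have [a [b ab]] := Gamma_segment t; exists a, b.
have GE : Gamma = (fun t => `[a t, b t]%classic) by apply/funext => t; exact: (abP t).2.
have a_le_b t : a t <= b t by exact: (abP t).1.
have a_ge0 t : 0 <= a t.
  have /(_ (a t)) := Gamma_sub t; rewrite GE /= !in_itv /= lexx a_le_b.
  by move=> /(_ isT)/andP[].
have b_lt1 t : b t < 1.
  have /(_ (b t)) := Gamma_sub t; rewrite GE /= !in_itv /= lexx a_le_b.
  by move=> /(_ isT)/andP[].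
rewrite GE in Gamma_disjoint Gamma_locally_finite *.
have /choice[zeta /choice[delta gap]] := fun l =>
  compact_gap (K_compact l) (K_circle l) (K_connected l).
have z1 l : cmod (zeta l) = 1 by have [] := gap l.
have d0 l : 0 < delta l by have [] := gap l.
have KP l z : K l z -> cmod z = 1 /\ delta l <= cmod (z - zeta l).
  by have [_ _] := gap l; exact.
(* [Q.1] is a polynomial near the centre of the ball, [Q.2.1] a quarter of its
   radius, and [Q.2.2] a Lipschitz constant of [Q.1] on the disc *)
have V_poly (ln : nat * nat) : exists Q : {poly R[i]} * (R * R),
    [/\ 0 < Q.2.1, 0 <= Q.2.2,
     (forall z w, cmod z <= 1 -> cmod w <= 1 ->
        cmod (Q.1.[z] - Q.1.[w]) <= Q.2.2 * cmod (z - w)) &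
     forall u : R[i] -> R[i], {within K ln.1, continuous u} ->
       (forall z, K ln.1 z -> cmod (u z - Q.1.[z]) <= 2 * Q.2.1) ->
       restriction_in u (V ln.1 ln.2)].
  case: ln => l n /=; have [h [eta [eta0 VE]]] := V_ball l n.
  have eta4 : 0 < eta / 4 by rewrite divr_gt0.
  have [q qP] := approx_continuous h (z1 l) (d0 l) (@KP l) eta4.
  have [C C0 CP] := horner_lipschitz q.
  exists (q, (eta / 4, C)); split=> //= u uc uq.
  have uc' := (subspace_sigL_continuousP (K l) u).1 uc.
  exists (mkcts uc' : continuous_on_compact (K_compact l)) => //.
  rewrite VE -ball_normE /= cts_normE ltcR.
  apply: (@le_lt_trans _ _ (eta / 4 + 2 * (eta / 4))); last by lra.
  apply: sup_cmod_le => [|x]; first by lra.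
  have Kx : K l (val x) by apply: set_mem; exact: valP.
  have := cmod_dist_le (h x) (u (val x)) q.[val x].
  rewrite (cmodBC q.[val x]) => h3.
  exact: le_trans h3 (lerD (qP x) (uq _ Kx)).
have /choice[Q QP] := V_poly.
pose P (t : nat * nat * nat) := (Q t.1).1.
pose e := eps / 2.
have e0 : 0 < e by rewrite divr_gt0.
have [f [fh fg fP]] := prescribed_on_segments a_ge0 a_le_b b_lt1 Gamma_disjoint
  Gamma_locally_finite (fun t => z1 t.1.1) (fun t => d0 t.1.1)
  (fun t => @KP t.1.1) P g_holomorphic rho_ge0 e0.
have rho1 : rho < 1.
  have : unit_disc R rho%:C.
    by apply: D_sub; rewrite /closed_disc /= cmod_real ger0_norm.
  by rewrite /unit_disc /= cmod_real ger0_norm.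
(* Beyond [r0] only segments that have been treated occur, with a rank so large
   that the error made on them is at most a quarter of the radius of the ball,
   and dilations move the polynomial by at most another quarter. *)
have /choice[r_ rP] (ln : nat * nat) : exists r0 : R, [/\ 0 <= r0, r0 < 1,
    (forall t, a t <= rho -> b t < r0),
    (forall t, (Q ln).2.1 < e / 2 ^+ rank a t -> b t < r0) &
    (Q ln).2.2 * (1 - r0) <= (Q ln).2.1].
  have [q0 C0 _ _] := QP ln; set q := _.2.1 in q0 *; set C := _.2.2 in C0 *.
  have [k kP] := geometric_small e q0.
  have [|||r0 [yr r01 br]] := @finite_right_bound R _ b
    ([set t | a t <= rho] `|` [set t | (rank a t < k)%N])
    (Num.max 0 (1 - q / (C + 1))) 1.
  - rewrite finite_setU; split.
      exact: (finite_left_le a_ge0 a_le_b Gamma_locally_finite rho1).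
    exact: (finite_rank_lt a_ge0 a_le_b b_lt1 Gamma_disjoint Gamma_locally_finite).
  - by rewrite gt_max ltr01 ltrBlDr ltrDl divr_gt0// ltr_wpDl.
  - by move=> t _.
  move: yr; rewrite gt_max => /andP[r00 r0C]; exists r0; split=> //.
  - exact: ltW.
  - by move=> t art; apply: br; left.
  - by move=> t qt; apply: br; right => /=; rewrite ltnNge; apply/negP => /kP; lra.
  have : 1 - r0 < q / (C + 1) by lra.
  by rewrite ltr_pdivlMr; last rewrite ltr_wpDl//; nra.
exists (fun l n => r_ (l, n)), f; split=> //.
- by move=> l n; have [r00 r01 _ _ _] := rP (l, n); rewrite /= in_itv /= r00.
- apply: (@le_lt_trans _ _ e%:E); last by rewrite lte_fin /e; lra.
  apply: ge_ereal_sup => _ [z zrho <-]; rewrite lee_fin; apply: fg => //.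
  exact: le_lt_trans zrho rho1.
move=> l n r [[m _]]; rewrite /= !in_itv /= => /andP[ar rb] /andP[rr r1].
have [r00 _ r0rho r0k r0C] := rP (l, n); have [q0 C0 QL QV] := QP (l, n).
have art : rho < a (l, n, m).
  by rewrite ltNge; apply/negP => /r0rho; lra.
have small : e / 2 ^+ rank a (l, n, m) <= (Q (l, n)).2.1.
  by rewrite leNgt; apply/negP => /r0k; lra.
have r0 : 0 <= r by lra.
apply: (QV (f \o dilation r)) => /=.
  apply/continuous_in_subspaceT => z /set_mem Kz; apply: continuous_comp.
    by apply: ctsZ => x; exact: cvg_id.
  apply: (holomorphic_continuous fh); rewrite /unit_disc /= /dilation cmodM cmod_real.
  by rewrite ger0_norm// (K_circle l z Kz) mulr1.
move=> z Kz; have z1' : cmod z = 1 := K_circle l z Kz.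
have := fP (l, n, m) r z art ar rb Kz.
have rz1 : cmod (r%:C * z) <= 1 by rewrite cmodM cmod_real z1' mulr1 ger0_norm// ltW.
have := QL (r%:C * z) z rz1; rewrite z1' => /(_ (lexx _)).
have -> : r%:C * z - z = (r - 1)%:C * z by rewrite rmorphB /= rmorph1; ring.
rewrite cmodM z1' mulr1 cmod_real ler0_norm; last by lra.
move=> h1 h2.
have := cmod_dist_le (f (r%:C * z)) (Q (l, n)).1.[z] (P (l, n, m)).[r%:C * z].
rewrite /P /= in h2 *; rewrite /dilation.
have h3 : (Q (l, n)).2.2 * - (r - 1) <= (Q (l, n)).2.2 * (1 - r_ (l, n)).
  by rewrite ler_wpM2l//; lra.
lra.
Qed.
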